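(* Let $\mathcal K$ be a $K$-category, $I$ a weighted branched cover of $\mathcal K$, and $S$ a sheaf on $\mathcal K$. If $S$ satisfies the Patching and Extension axioms, then the sheaf $S^I$ of weighted branched sections of $S$ obeys the Patching and Extension axioms.
   Context: Everything takes place over the category of $C^{\infty,\underline1}$ exploded manifolds (in the sense of B. Parker: spaces with a sheaf of $\mathbb C^*\mathfrak t^{\mathbb R}$-valued functions locally modelled on open subsets of $\mathbb R^n\times\mathbf T^m_P$, where $\mathbf T^m_P$ is the set of $\tilde z\in(\mathbb C^*\mathfrak t^{\mathbb R})^m$ whose tropical part lies in the integral affine polytope $P$; smooth manifolds are a full subcategory). A stack means a stack over this category, with structure functor $\mathbf F$; an object $\hat f$ is a family parametrized by $\mathbf F(\hat f)$, and $f$ is a curve if $\mathbf F(f)$ is a point. A $K$-category is a full subcategory $\mathcal K$ of a stack $\mathcal K^{st}$ with charts $\hat f_i/G_i$ such that: (1) $\hat f_i$ is a family in $\mathcal K^{st}$, $G_i$ a finite group of automorphisms; (2) $\hat f_i/G_i$ represents a substack of $\mathcal K^{st}$ (a full subcategory containing $\hat f$ iff it contains every curve in $\hat f$); (3) each $\hat f_i$ has fixed dimension, and if $\dim\hat f_i\le\dim\hat f_j$, $\hat f_i\times_{\mathcal K^{st}}\hat f_j\to\hat f_i$ is a $G_j$-fold cover of an open subfamily, and $\hat f_i\times_{\mathcal K^{st}}\hat f_j\to\hat f_j$ is a $G_i$-fold cover of a subfamily locally defined by transverse vanishing of $\mathbb R$-valued functions on $\mathbf F(\hat f_j)$; (4)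 the $\hat f_i$ cover $\mathcal K^{st}$; (5) there are countably many charts and each $\hat f_i$ meets finitely many $\hat f_j$; (6) $\mathcal K$ consists of the families locally isomorphic to some $\hat f_i$. A sheaf on $\mathcal K$ is a contravariant functor to sets restricting to a sheaf on the open subfamilies of each family. A weighted branched cover $I$ of $\mathcal K$ is a contravariant functor with domain a full subcategory $\mathcal O_I\subset\mathcal K^{st}$ such that all $O\in\mathcal O_I$ are connected; if $O_1\in\mathcal K^{st}$ is connected and there is a morphism $O_1\to O_2\in\mathcal O_I$ then $O_1\in\mathcal O_I$; and every family in $\mathcal K$ has an open cover contained in $\mathcal O_I$. Its target is the category of triples $(I(O),\mu,\equiv)$ where $I(O)$ is a finite set, $\mu$ a probability measure on it with every point of positive rational measure, $\equiv$ an equivalence relation on $I(O)$; a morphism $\iota^*:I(O_2)\to I(O_1)$ is a measure preserving map such that $i\equiv j$ if $\iota^*i\equiv\iota^*j$. It is assumed that for any curve $f$ and morphism $f\to O$ in $\mathcal O_I$ there is a neighborhood $U\subset O$ of $f$ with $(I(U),\mu,\equiv)\to(I(f),\mu,\equiv)$ an isomorphism. $i,j\in I(O)$ are separated at $f$ if their images in $I(f)$ are not equivalent. For $\hat f$ in $\mathcal K$, let $\mathcal O_{I,\hat f}$ be the category of families in $\mathcal O_I\cap\mathcal K$ with a given map to $\hat f$. $S^I(\hat f)$ is the set of natural transformations $\nu$ from $I$ to $S$ (as set-valued functors on $\mathcal O_{I,\hat f}$) such that for $O$ in $\mathcal O_{I,\hat f}$ and $i,j\in I(O)$ not separated at $f$,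 $\nu(i)=\nu(j)$ on a neighborhood of $f$. Pullback along $\hat g\to\hat f$ is via $\mathcal O_{I,\hat g}\to\mathcal O_{I,\hat f}$. $S^I$ is a sheaf on $\mathcal K$. Axioms for a sheaf $T$ on $\mathcal K$. *Patching:* given an open cover $\{O_k\}$ of $\hat f$ and $\theta_k\in T(O_k)$ for all $k$, there exists $\theta\in T(\hat f)$ such that, for any morphism $\hat g\to\hat f$ in $\mathcal K$ and $\theta'\in T(\hat g)$, the pullback of $\theta$ to $\hat g$ is $\theta'$ whenever for all $k$ the sections $\theta'$ and $\theta_k$ have the same pullback to $\hat g\times_{\hat f}O_k$. *Extension:* $T(\hat f)$ is nonempty; and for any morphism $\hat g\to\hat f$ in $\mathcal K$, $\theta\in T(\hat g)$ and curve $f$ in $\hat g$, there is $\theta'\in T(\hat f)$ whose pullback to $\hat g$ agrees with $\theta$ in a neighborhood of $f$. *)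

(* Defs.v *)
From HB Require Import structures.
From mathcomp Require Import all_boot all_order all_algebra all_fingroup.
From mathcomp Require Import complex.
From mathcomp Require Import all_classical all_reals all_analysis.
Set Implicit Arguments.
Unset Strict Implicit.
Unset Printing Implicit Defensive.
Import Order.TTheory GRing.Theory Num.Theory.
Import numFieldNormedType.Exports.
Local Open Scope classical_set_scope.
Local Open Scope ring_scope.

Record category := Category {
  ob :> Type;
  hom : ob -> ob -> Type;
  idm : forall x, hom x x;
  comp : forall x y z, hom y z -> hom x y -> hom x z;
  comp1m : forall x y (f : hom x y), comp (idm y) f = f;
  compm1 : forall x y (f : hom x y), comp f (idm x) = f;
  compA : forall x y z w (f : hom z w) (g : hom y z) (h : hom x y),
    comp f (comp g h) = comp (comp f g) h
}.
Arguments hom {c} _ _.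
Arguments idm {c} _.
Arguments comp {c x y z} _ _.

Notation "f \c g" := (comp f g) (at level 40, left associativity).

Record functor (C D : category) := Functor {
  fob :> C -> D;
  fmap : forall x y : C, hom x y -> hom (fob x) (fob y);
  fmap1 : forall x, fmap (idm x) = idm (fob x);
  fmapM : forall x y z (f : hom y z) (g : hom x y),
    fmap (f \c g) = fmap f \c fmap g
}.
Arguments fmap {C D} _ {x y} _.

Record cofunctor (C D : category) := Cofunctor {
  cob :> C -> D;
  cmap : forall x y : C, hom x y -> hom (cob y) (cob x);
  cmap1 : forall x, cmap (idm x) = idm (cob x);
  cmapM : forall x y z (f : hom y z) (g : hom x y),
    cmap (f \c g) = cmap g \c cmap f
}.
Arguments cmap {C D} _ {x y} _.

(* Set-valued contravariant functors; kept apart from [cofunctor] because a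
   category of types, as an instance of [category], would have to live in a
   universe above that of its objects. *)
Record presheaf (C : category) := Presheaf {
  sec :> C -> Type;
  res : forall x y : C, hom x y -> sec y -> sec x;
  res1 : forall x (s : sec x), res (idm x) s = s;
  resM : forall x y z (f : hom y z) (g : hom x y) (s : sec z),
    res (f \c g) s = res g (res f s)
}.
Arguments res {C} _ {x y} _ _.

Definition full (C : category) (P : C -> Prop) : category :=
  @Category {x : C | P x} (fun x y => hom (sval x) (sval y))
    (fun x => idm (sval x)) (fun x y z f g => comp f g)
    (fun x y f => comp1m f) (fun x y f => compm1 f)
    (fun x y z w f g h => compA f g h).

Definition is_iso (C : category) (x y : C) (f : hom x y) : Prop :=
  exists g : hom y x, g \c f = idm x /\ f \c g = idm y.

Definition is_product (C : category) (x y p : C) (p1 : hom p x) (p2 : hom p y)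
    : Prop :=
  forall (z : C) (a : hom z x) (b : hom z y),
    exists! c : hom z p, p1 \c c = a /\ p2 \c c = b.

Definition is_pullback (C : category) (x y b p : C) (f : hom x b) (g : hom y b)
    (p1 : hom p x) (p2 : hom p y) : Prop :=
  f \c p1 = g \c p2 /\
  forall (z : C) (a1 : hom z x) (a2 : hom z y), f \c a1 = g \c a2 ->
    exists! c : hom z p, p1 \c c = a1 /\ p2 \c c = a2.

Section ExplodedModels.
Variable R : realType.

(* [Etr c a] is c t^a. *)
Record etr := Etr { coef : R[i]; coef_neq0 : coef != 0; expo : R }.

Definition etr_mul (x y : etr) : etr :=
  Etr (mulf_neq0 (coef_neq0 x) (coef_neq0 y)) (expo x + expo y).

Definition etr_t (a : R) : etr := Etr (oner_neq0 _) a.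

Definition cexp (w : R[i]) : R[i] :=
  Complex (expR (complex.Re w) * cos (complex.Im w))
          (expR (complex.Re w) * sin (complex.Im w)).

Lemma cexp_neq0 (w : R[i]) : cexp w != 0.
Proof.
rewrite eq_complex /= !mulf_eq0 !(gt_eqF (expR_gt0 _)) /=.
apply/negP => /andP[/eqP c0 /eqP s0]; have := cos2Dsin2 (complex.Im w).
by rewrite c0 s0 !expr0n /= addr0 => /esym/eqP; rewrite oner_eq0.
Qed.

Definition etr_exp (w : R[i]) : etr := Etr (cexp_neq0 w) 0.

(* A pair (alpha, a) with alpha in Z^m stands for the monomial t^a z^alpha,
   whose tropical part is the affine function a + alpha.u. *)
Definition monomial (m : nat) : Type := 'rV[int]_m * R.

Definition mono_trop m (z : monomial m) (u : 'rV[R]_m) : R :=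
  z.2 + \sum_i (z.1 0 i)%:~R * u 0 i.

(* A polytope is given by finitely many inequalities a + alpha.u >= 0, or > 0
   when the boolean is true. *)
Record polytope (m : nat) := Polytope {
  ineqs : seq (monomial m * bool);
  pset : set 'rV[R]_m := [set u | all (fun c : monomial m * bool =>
    if c.2 then 0 < mono_trop c.1 u else 0 <= mono_trop c.1 u) ineqs];
  pset_int : interior pset !=set0
}.

Definition trop m (z : 'rV[etr]_m) : 'rV[R]_m := \row_i expo (z 0 i).

Record mpt (n m : nat) (P : polytope m) := Mpt {
  mx : 'rV[R]_n;
  mz : 'rV[etr]_m;
  mP : pset P (trop mz)
}.

Section Model.
Variables (n m : nat) (P : polytope m).
Local Notation T := (mpt n P).

Definition mtrop (p : T) : 'rV[R]_m := trop (mz p).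

Definition mono_coef (z : monomial m) (p : T) : R[i] :=
  \prod_i coef (mz p 0 i) ^ z.1 0 i.

Definition smooth_mono (z : monomial m) : Prop :=
  forall u, pset P u -> 0 <= mono_trop z u.

(* the smooth part, where c t^0 has smooth part c, and c t^a has smooth part 0
   for a > 0 *)
Definition smooth_part (z : monomial m) (p : T) : R[i] :=
  if mono_trop z (mtrop p) == 0 then mono_coef z p else 0.

HB.instance Definition _ := gen_eqMixin T.
HB.instance Definition _ := gen_choiceMixin T.

(* The coarsest topology in which the coordinates on R^n and the smooth parts
   of smooth monomials are continuous. It is not Hausdorff: points which differ
   only within a stratum of P may be indistinguishable. *)
Definition model_subbase : set (set T) :=
  [set A | (exists i c e, A = [set p | `|mx p 0 i - c| < e]) \/
    (exists z c e, smooth_mono z /\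
       A = [set p | Normc.normc (smooth_part z p - c) < e])].

HB.instance Definition _ :=
  @isSubBaseTopological.Build T (set T) model_subbase id.

(* Real tangent vectors at a point: the real span of d/dx_i and of the real and
   imaginary parts of z_i d/dz_i. The vector (v, w) is the derivative at s = 0
   of s |-> (x + s v, exp (s w) z). *)
Definition tvect : Type := 'rV[R]_n * 'rV[R[i]]_m.

Definition zflow (w : 'rV[R[i]]_m) (s : R) (z : 'rV[etr]_m) : 'rV[etr]_m :=
  \row_i etr_mul (etr_exp ((s%:C)%C * w 0 i)) (z 0 i).

Lemma trop_zflow w s z : trop (zflow w s z) = trop z.
Proof. by apply/rowP => i; rewrite !mxE /= add0r. Qed.

Lemma zflow_in (w : 'rV[R[i]]_m) (s : R) (p : T) :
  pset P (trop (zflow w s (mz p))).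
Proof. by rewrite trop_zflow; exact: mP. Qed.

Definition flow (V : tvect) (s : R) (p : T) : T :=
  Mpt (mx p + s *: V.1) (zflow_in V.2 s p).

Definition Dv (V : tvect) (g : T -> R) (p : T) : R :=
  derive1 (fun s : R => g (flow V s p)) 0.

Definition Dvs (Vs : seq tvect) (g : T -> R) : T -> R := foldr Dv g Vs.

(* (x, z) |-> (x, t^a z); left alone if the result is not in the model, which
   does not happen where [shift] is used in [C1on] *)
Definition shift (a : 'rV[R]_m) (p : T) : T :=
  if pselect (pset P (trop (\row_i etr_mul (etr_t (a 0 i)) (mz p 0 i))))
    is left H then Mpt (mx p) H else p.

(* Delta_S = 1 - e_S with e_S g = g o t^a, for a stratum S reached by moving
   in the direction a. *)
Definition Delta (a : 'rV[R]_m) (g : T -> R) (p : T) : R :=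
  g p - g (shift a p).

Definition Deltas (l : seq 'rV[R]_m) (g : T -> R) : T -> R := foldr Delta g l.

(* u is in the closure of the stratum (open face) of P containing v *)
Definition in_closure (u v : 'rV[R]_m) : Prop :=
  forall z, smooth_mono z -> mono_trop z v = 0 -> mono_trop z u = 0.

(* Regularity C^{oo,1} on an open subset N: g is C^k for all k, and for all
   delta < 1, every nonempty finite collection of strata S_1, ..., S_k near a
   point q of N and every iterated derivative D,
     |Delta_{S_1} ... Delta_{S_k} D g| <= C w^delta  near q,
   where w is the sum of the absolute values of finitely many smooth monomials
   vanishing on all the S_i. Here P is viewed as a cone near the point u, the
   stratum S_i is that of u + k a_i, and u is in the closure of each S_i; then
   S_i also contains u + a_i, and by convexity P contains u plus the sum of any
   subset of the a_i. The strata near q are those in the closure of the stratum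
   of q. By density of the points of tropical part u near q, it is enough to
   bound Delta_{S_1} ... Delta_{S_k} D g there. *)
Definition C1on (N : set T) (g : T -> R) : Prop :=
  (forall (Vs : seq tvect) (p : T), N p ->
     {for p, continuous (Dvs Vs g)} /\
     forall V, derivable (fun s : R => Dvs Vs g (flow V s p)) 0 1) /\
  (forall (Vs : seq tvect) (q : T) (u : 'rV[R]_m) (l : seq 'rV[R]_m)
      (delta : R),
     N q -> pset P u -> l <> [::] -> 0 < delta < 1 ->
     {in l, forall a, let s := u + a *+ size l in
        [/\ pset P s, in_closure u s & in_closure s (mtrop q)]} ->
     exists (Z : seq (monomial m)) (C : R),
       {in Z, forall z, smooth_mono z /\
          {in l, forall a, 0 < mono_trop z (u + a *+ size l)}} /\
       \forall p \near q, mtrop p = u ->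
         `|Deltas l (Dvs Vs g) p| <=
           C * (\sum_(z <- Z) Normc.normc (smooth_part z p)) `^ delta).

(* A C^{oo,1} exploded function is locally of the form g t^a z^alpha with
   alpha in Z^m, a in R and g a C^{oo,1} function to C^*. *)
Definition model_germ (p : T) (f : T -> etr) : Prop :=
  exists (N : set T) (z : monomial m) (g : T -> R[i]),
    [/\ open N, N p, C1on N (fun q => complex.Re (g q)),
        C1on N (fun q => complex.Im (g q)) &
        forall q, N q -> coef (f q) = g q * mono_coef z q /\
                         expo (f q) = mono_trop z (mtrop q)].

End Model.

(* A sheaf of C^*t^R-valued functions is given by its germs: [germ x f] means
   that f is a section near x, and f is a section over an open U if it is one
   near every point of U. *)
Record espace := ESpace {
  pts :> topologicalType;
  germ : pts -> (pts -> etr) -> Prop;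
  germ_near : forall x f, germ x f -> \forall y \near x, germ y f;
  germ_ext : forall x f g, germ x f -> (\forall y \near x, f y = g y) ->
    germ x g
}.

Record emor (B C : espace) := EMor {
  efn :> B -> C;
  efn_cont : continuous efn;
  efn_germ : forall x f, germ (efn x) f -> germ x (f \o efn)
}.

Lemma emor_eq (B C : espace) (f g : emor B C) : efn f = efn g -> f = g.
Proof.
case: f => f fc fg; case: g => g gc gg /= fg_eq.
by case: _ / fg_eq gc gg => gc gg; congr EMor; exact: Prop_irrelevance.
Qed.

Program Definition emor_id (B : espace) : emor B B := @EMor B B id _ _.
Next Obligation. by move=> B x; exact: cvg_id. Qed.
Next Obligation. by []. Qed.

Program Definition emor_comp (B C D : espace) (f : emor C D) (g : emor B C) :
  emor B D := @EMor B D (f \o g) _ _.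
Next Obligation.
move=> B C D f g x; apply: continuous_comp; exact: efn_cont.
Qed.
Next Obligation.
by move=> B C D f g x h /efn_germ /efn_germ.
Qed.

Lemma model_germ_near n m (P : polytope m) (x : mpt n P) f :
  model_germ x f -> \forall y \near x, model_germ y f.
Proof.
case=> N [z] [g] [oN Nx g1 g2 fE].
by apply: filterS (open_nbhs_nbhs (conj oN Nx)) => y Ny; exists N, z, g.
Qed.

Lemma C1on_sub n m (P : polytope m) (N N' : set (mpt n P)) g :
  N' `<=` N -> C1on N g -> C1on N' g.
Proof.
move=> sub [h1 h2]; split=> [Vs p /sub|]; first exact: h1.
move=> Vs q u l d /sub; exact: h2.
Qed.

Lemma model_germ_ext n m (P : polytope m) (x : mpt n P) f g :
  model_germ x f -> (\forall y \near x, f y = g y) -> model_germ x g.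
Proof.
case=> N [z] [h] [oN Nx h1 h2 fE] fg.
exists (N `&` interior [set y | f y = g y]), z, h; split.
- by apply: openI => //; exact: open_interior.
- by [].
- by apply: C1on_sub h1 => y [].
- by apply: C1on_sub h2 => y [].
- by move=> q [Nq /nbhs_singleton /= <-]; exact: fE.
Qed.

Definition model n m (P : polytope m) : espace :=
  @ESpace (mpt n P) (@model_germ n m P) (@model_germ_near n m P)
    (@model_germ_ext n m P).

Section OpenSubspace.
Variables (B : espace) (U : set B).

Definition sub_germ (x : set_type U) (f : set_type U -> etr) : Prop :=
  exists F : B -> etr, germ (set_val x) F /\
    \forall y \near x, f y = F (set_val y).

Lemma sub_germ_near x f : sub_germ x f -> \forall y \near x, sub_germ y f.
Proof.
case=> F [/germ_near gF fF].
have vc : {for x, continuous (set_val : set_type U -> B)}.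
  exact: initial_continuous.
have gF' : \forall y \near x, germ (set_val y) F by exact: (vc _ gF).
have fF' : \forall y \near x, \forall y' \near y, f y' = F (set_val y').
  by move: fF => /nbhs_interior.
by near=> y; exists F; split; [near: y|near: y].
Unshelve. all: by end_near. Qed.

Lemma sub_germ_ext x f g : sub_germ x f -> (\forall y \near x, f y = g y) ->
  sub_germ x g.
Proof.
case=> F [gF fF] fg; exists F; split=> //.
by apply: filterS2 fF fg => y -> .
Qed.

Definition sub : espace := @ESpace (set_type U) sub_germ sub_germ_near
  sub_germ_ext.
End OpenSubspace.
Arguments sub {B} U.

Definition open_emb (B C : espace) (h : emor B C) : Prop :=
  exists (U : set C) (f : emor B (sub U)) (g : emor (sub U) B),
    [/\ open U, cancel f g, cancel g f & forall x, set_val (f x) = h x].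

Definition is_chart (B : espace) n m (P : polytope m) (W : set (model n P))
    (h : emor (sub W) B) : Prop := open W /\ open_emb h.

(* The topological condition replaces "Hausdorff and second countable", which
   can only be asked of the quotient of B by topological indistinguishability;
   that quotient is locally compact, so for it Hausdorff and regular are the
   same. *)
Definition is_emanifold (B : espace) : Prop :=
  [/\ @second_countable B, @regular_space B &
      forall x : B, exists n m (P : polytope m) (W : set (model n P))
        (h : emor (sub W) B), is_chart h /\ range h x].

Definition emanifold : Type := {B : espace | is_emanifold B}.

Program Definition expl : category :=
  @Category emanifold (fun B C => emor (sval B) (sval C))
    (fun B => emor_id (sval B)) (fun B C D f g => emor_comp f g) _ _ _.
Next Obligation. by move=> *; exact: emor_eq. Qed.
Next Obligation. by move=> *; exact: emor_eq. Qed.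
Next Obligation. by move=> *; exact: emor_eq. Qed.

Definition is_point (B : espace) : Prop := exists x : B, forall y : B, y = x.

Definition has_dim (B : espace) (d : nat) : Prop :=
  forall x : B, exists n m (P : polytope m) (W : set (model n P))
    (h : emor (sub W) B), [/\ is_chart h, range h x & d = (n + m.*2)%N].

(* The empty space does not count as connected. *)
Definition is_connected (B : espace) : Prop :=
  [set: B] !=set0 /\ connected [set: B].

Definition covering (A : Type) (B : emanifold) (C : A -> emanifold)
    (h : forall a, @hom expl (C a) B) : Prop :=
  (forall a, open_emb (h a)) /\ forall x : sval B, exists a, range (h a) x.

(* h realizes its domain as a subspace of C defined, in a chart near each of
   its points, by the transverse vanishing of k real-valued functions g_l; the
   zero locus is characterized as the equalizer of (g_l) and 0. *)
Definition transverse_locus (B C : emanifold) (h : @hom expl B C) : Prop :=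
  forall x : sval B, exists n m (P : polytope m) (W : set (model n P))
    (c : emor (sub W) (sval C)) (k : nat) (g : 'I_k -> model n P -> R),
    [/\ is_chart c, range c (h x),
        (forall l, C1on W (g l)) /\
        (forall q, W q -> (forall l, g l q = 0) ->
           forall e : 'I_k -> R, exists V, forall l, Dv V (g l) q = e l),
        forall (y : sval B) (q : sub W),
          h y = c q -> forall l, g l (set_val q) = 0 &
        forall (D : emanifold) (a : @hom expl D C),
          (forall d : sval D, exists q : sub W,
             a d = c q /\ forall l, g l (set_val q) = 0) ->
          exists! b : @hom expl D B, h \c b = a].

End ExplodedModels.

Section Stacks.
Variable R : realType.

(* phi lies over f; in particular F x is the domain of f *)
Inductive lies_over (C : category) (F : functor C (expl R)) (x y : C)
    (phi : hom x y) : forall B : expl R, hom B (F y) -> Prop :=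
  LiesOver : lies_over phi (fmap F phi).

Record stack := Stack {
  tot :> category;
  stF : functor tot (expl R);
  (* fibred in groupoids *)
  st_lift : forall (y : tot) (B : expl R) (f : hom B (stF y)),
    exists (x : tot) (phi : hom x y), lies_over phi f;
  st_cart : forall (x y z : tot) (phi : hom x y) (psi : hom z y)
    (h : hom (stF z) (stF x)), fmap stF phi \c h = fmap stF psi ->
    exists! chi : hom z x, fmap stF chi = h /\ phi \c chi = psi;
  (* morphisms form a sheaf *)
  st_glue_mor : forall (A : Type) (x y : tot) (xa : A -> tot)
    (u : forall a, hom (xa a) x) (h : hom (stF x) (stF y))
    (psi : forall a, hom (xa a) y),
    covering (fun a => fmap stF (u a)) ->
    (forall a, fmap stF (psi a) = h \c fmap stF (u a)) ->
    (forall a b z (i : hom z (xa a)) (j : hom z (xa b)),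
       u a \c i = u b \c j -> psi a \c i = psi b \c j) ->
    exists! phi : hom x y, fmap stF phi = h /\ forall a, phi \c u a = psi a;
  (* descent data are effective: xab is an object over the overlap with maps
     p, q to xa and xb, and the second hypothesis on it is the cocycle
     condition *)
  st_descent : forall (A : Type) (B : expl R) (xa : A -> tot)
    (f : forall a, hom (stF (xa a)) B) (xab : A -> A -> tot)
    (p : forall a b, hom (xab a b) (xa a))
    (q : forall a b, hom (xab a b) (xa b)),
    covering f ->
    (forall a b, is_pullback (f a) (f b) (fmap stF (p a b))
                   (fmap stF (q a b))) ->
    (forall a b c z (i : hom z (xab a b)) (j : hom z (xab b c))
       (k : hom z (xab a c)),
       q a b \c i = p b c \c j -> p a b \c i = p a c \c k ->
       q b c \c j = q a c \c k) ->
    exists (x : tot) (e : hom (stF x) B) (phi : forall a, hom (xa a) x),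
      [/\ is_iso e, forall a, e \c fmap stF (phi a) = f a &
          forall a b, phi a \c p a b = phi b \c q a b]
}.

Variable X : stack.
Local Notation F := (stF X).

Definition space (x : X) : espace R := sval (F x).

Definition smap (x y : X) (u : hom x y) : emor (space x) (space y) :=
  fmap F u.

Definition open_sub (x y : X) (u : hom x y) : Prop := open_emb (smap u).

Definition open_cover (A : Type) (y : X) (x : A -> X)
    (u : forall a, hom (x a) y) : Prop :=
  (forall a, open_sub (u a)) /\
  forall p : space y, exists a, range (smap (u a)) p.

Definition is_curve (f : X) : Prop := is_point (space f).

(* "a full subcategory containing y iff it contains every curve in y" *)
Definition is_substack (U : X -> Prop) : Prop :=
  forall y, U y <-> forall (f : X) (phi : hom f y), is_curve f -> U f.

Definition is_action (G : finGroupType) (x : X) (rho : G -> hom x x) : Prop :=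
  rho 1%g = idm x /\ forall g h, rho (g * h)%g = rho g \c rho h.

(* q : P -> y is a G-fold cover: locally on y it is G times an open subfamily,
   with G permuting the sheets simply transitively. *)
Definition fold_cover (G : finGroupType) (P y : X) (q : hom P y)
    (act : G -> hom P P) : Prop :=
  [/\ is_action act, forall g, q \c act g = q &
      forall x : space y, exists (U : X) (u : hom U y) (s : hom U P),
        [/\ open_sub u, range (smap u) x, q \c s = u,
            forall g, open_sub (act g \c s) &
            forall w : space P, range (smap u) (smap q w) ->
              exists! g, range (smap (act g \c s)) w]].

(* A map from y to x/G is a G-fold cover P of y together with a G-equivariant
   map r from P to x. *)
Definition quotient_map (G : finGroupType) (x : X) (rho : G -> hom x x)
    (y P : X) (p : hom P y) (act : G -> hom P P) (r : hom P x) : Prop :=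
  fold_cover p act /\ forall g, r \c act g = rho g \c r.

(* x/G represents the substack U: the families in U are those admitting a map
   to x/G, and this map is unique up to unique isomorphism. *)
Definition represents (G : finGroupType) (x : X) (rho : G -> hom x x)
    (U : X -> Prop) : Prop :=
  forall y : X,
    (U y <-> exists P p act r, @quotient_map G x rho y P p act r) /\
    forall P p act r P' p' act' r',
      @quotient_map G x rho y P p act r ->
      @quotient_map G x rho y P' p' act' r' ->
      exists! h : hom P P',
        [/\ p' \c h = p, r' \c h = r & forall g, h \c act g = act' g \c h].

Definition meets (x y : X) : Prop :=
  exists (f : X) (a : hom f x) (b : hom f y), is_curve f.

(* The fibre product of families over the stack is their product in the total
   category: a map to it from B is a pair of maps f : B -> F x, g : B -> F y
   and an isomorphism between the pullbacks of x and y to B, that is, up to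
   isomorphism, an object over B with a morphism to x and one to y. *)
Record Kcategory := MkKcategory {
  kidx : countType;
  kfam : kidx -> X;
  kgrp : kidx -> finGroupType;
  kact : forall i, kgrp i -> hom (kfam i) (kfam i);
  kactP : forall i, is_action (@kact i) /\ injective (@kact i);
  krep : forall i, exists U, is_substack U /\ represents (@kact i) U;
  kdim : kidx -> nat;
  kdimP : forall i, has_dim (space (kfam i)) (kdim i);
  kprod : forall i j, (kdim i <= kdim j)%N ->
    exists (P : X) (p1 : hom P (kfam i)) (p2 : hom P (kfam j)),
      [/\ is_product p1 p2,
          exists (W : X) (u : hom W (kfam i)) (q : hom P W)
            (act : kgrp j -> hom P P),
            [/\ open_sub u, u \c q = p1, fold_cover q act &
                forall g, p2 \c act g = kact g \c p2] &
          exists (V : X) (v : hom V (kfam j)) (q : hom P V)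
            (act : kgrp i -> hom P P),
            [/\ transverse_locus (fmap F v), v \c q = p2, fold_cover q act &
                forall g, p1 \c act g = kact g \c p1]];
  kcover : forall f : X, is_curve f -> exists i (phi : hom f (kfam i)), True;
  kfinite : forall i, exists s : seq kidx,
    forall j, meets (kfam i) (kfam j) -> j \in s
}.

Variable K : Kcategory.

(* locally isomorphic to some chart *)
Definition inK (y : X) : Prop :=
  forall x : space y, exists (U : X) (u : hom U y) (i : kidx K)
    (v : hom U (kfam i)), [/\ open_sub u, range (smap u) x & open_sub v].

Definition Kcat : category := full inK.

Definition is_sheaf (T : presheaf Kcat) : Prop :=
  forall (A : Type) (y : Kcat) (x : A -> Kcat)
    (u : forall a, hom (x a) y) (t : forall a, T (x a)),
    open_cover (fun a => u a : @hom X _ _) ->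
    (forall a b (z : Kcat) (i : hom z (x a)) (j : hom z (x b)),
       u a \c i = u b \c j -> res T i (t a) = res T j (t b)) ->
    exists! s : T y, forall a, res T (u a) s = t a.

Definition Patching (T : presheaf Kcat) : Prop :=
  forall (A : Type) (y : Kcat) (x : A -> Kcat)
    (u : forall a, hom (x a) y) (t : forall a, T (x a)),
    open_cover (fun a => u a : @hom X _ _) ->
    exists s : T y, forall (z : Kcat) (phi : hom z y) (s' : T z),
      (forall a (w : Kcat) (p1 : hom w z) (p2 : hom w (x a)),
         is_pullback phi (u a) p1 p2 -> res T p1 s' = res T p2 (t a)) ->
      res T phi s = s'.

Definition Extension (T : presheaf Kcat) : Prop :=
  (forall y : Kcat, inhabited (T y)) /\
  forall (z y : Kcat) (phi : hom z y) (t : T z) (f : X)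
    (c : hom f (sval z)), is_curve f ->
    exists (s : T y) (U : Kcat) (u : hom U z) (d : hom f (sval U)),
      [/\ open_sub (u : @hom X _ _), (u : @hom X _ _) \c d = c &
          res T u (res T phi s) = res T u t].

Record wset := WSet {
  wpts :> finType;
  wmu : wpts -> rat;
  wmu_gt0 : forall i, 0 < wmu i;
  wmu_sum : \sum_i wmu i = 1;
  weq : rel wpts;
  weqP : equivalence_rel weq
}.

Record wmor (A B : wset) := WMor {
  wfn :> A -> B;
  wfn_mu : forall b, \sum_(a | wfn a == b) wmu a = wmu b;
  wfn_eq : forall i j, weq (wfn i) (wfn j) -> weq i j
}.

Lemma wmor_eq (A B : wset) (f g : wmor A B) : wfn f = wfn g -> f = g.
Proof.
case: f => f fc fg; case: g => g gc gg /= fg_eq.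
by case: _ / fg_eq gc gg => gc gg; congr WMor; exact: Prop_irrelevance.
Qed.

Program Definition wmor_id (A : wset) : wmor A A := @WMor A A id _ _.
Next Obligation. by move=> A b; rewrite big_pred1_eq. Qed.
Next Obligation. by []. Qed.

Program Definition wmor_comp (A B C : wset) (f : wmor B C) (g : wmor A B) :
  wmor A C := @WMor A C (f \o g) _ _.
Next Obligation.
move=> A B C f g c; rewrite -(wfn_mu f c).
rewrite (partition_big g (fun b => f b == c)) //=.
apply: eq_bigr => b /eqP fb; rewrite -(wfn_mu g b).
by apply: eq_bigl => a; case: (g a =P b) => [->|]; rewrite ?fb ?eqxx ?andbF.
Qed.
Next Obligation.
by move=> A B C f g i j /wfn_eq /wfn_eq.
Qed.

Program Definition wcat : category :=
  @Category wset wmor wmor_id wmor_comp _ _ _.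
Next Obligation. by move=> *; exact: wmor_eq. Qed.
Next Obligation. by move=> *; exact: wmor_eq. Qed.
Next Obligation. by move=> *; exact: wmor_eq. Qed.

(* In [wI_local], f lies in the domain of I whenever O does, as a point is
   connected. *)
Record branched_cover := BranchedCover {
  wdom : X -> Prop;
  wdom_conn : forall O, wdom O -> is_connected (space O);
  wdom_pull : forall (O1 O2 : X) (phi : hom O1 O2),
    is_connected (space O1) -> wdom O2 -> wdom O1;
  wdom_cover : forall y : X, inK y -> forall x : space y,
    exists (U : X) (u : hom U y), [/\ open_sub u, range (smap u) x & wdom U];
  wI :> cofunctor (full wdom) wcat;
  wI_local : forall (f O : full wdom) (phi : hom f O), is_curve (sval f) ->
    exists (U : full wdom) (u : hom U O) (psi : hom f U),
      [/\ open_sub (u : @hom X _ _), u \c psi = phi & is_iso (cmap wI psi)]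
}.

Section WeightedSections.
Variables (I : branched_cover) (S : presheaf Kcat).

(* the objects of O_{I,y} *)
Record slice (y : Kcat) := Slice {
  sl_ob : X;
  sl_I : wdom I sl_ob;
  sl_K : inK sl_ob;
  sl_map : hom sl_ob (sval y)
}.

Definition slI (y : Kcat) (o : slice y) : full (wdom I) :=
  exist _ (sl_ob o) (sl_I o).

Definition slK (y : Kcat) (o : slice y) : Kcat :=
  exist _ (sl_ob o) (@sl_K y o).

(* i and j are separated at the curve c : f -> O *)
Definition separated (O f : full (wdom I)) (c : hom f O) (i j : wI I O)
    : Prop :=
  ~~ weq (cmap I c i) (cmap I c j).

Record wsec (y : Kcat) := WSec {
  nu : forall o : slice y, wI I (slI o) -> S (slK o);
  nu_nat : forall (o1 o2 : slice y) (a : hom (sl_ob o1) (sl_ob o2)),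
    sl_map o2 \c a = sl_map o1 -> forall i : wI I (slI o2),
    res S (a : hom (slK o1) (slK o2)) (nu i) =
      nu (cmap I (a : hom (slI o1) (slI o2)) i);
  nu_sep : forall (o : slice y) (i j : wI I (slI o)) (f : full (wdom I))
    (c : hom f (slI o)), is_curve (sval f) -> ~ separated c i j ->
    exists (U : Kcat) (u : hom U (slK o)) (d : hom (sval f) (sval U)),
      [/\ open_sub (u : @hom X _ _), (u : @hom X _ _) \c d = c &
          res S u (nu i) = res S u (nu j)]
}.

Definition sl_push (x y : Kcat) (phi : hom x y) (o : slice x) : slice y :=
  @Slice y (sl_ob o) (sl_I o) (@sl_K x o) ((phi : @hom X _ _) \c sl_map o).

Lemma wsec_eq (y : Kcat) (m n : wsec y) : nu m = nu n -> m = n.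
Proof.
case: m => m m1 m2; case: n => n n1 n2 /= mn.
by case: _ / mn n1 n2 => n1 n2; congr WSec; exact: Prop_irrelevance.
Qed.

Program Definition wsec_res (x y : Kcat) (phi : hom x y) (m : wsec y) :
  wsec x := @WSec x (fun o => @nu y m (sl_push phi o)) _ _.
Next Obligation.
move=> x y phi m o1 o2 a oa i.
apply: (nu_nat m (o1 := sl_push phi o1) (o2 := sl_push phi o2)) => /=.
by rewrite -compA oa.
Qed.
Next Obligation.
move=> x y phi m o i j f c fc ij.
exact: (nu_sep m (o := sl_push phi o) fc ij).
Qed.

(* S^I *)
Program Definition weighted_sections : presheaf Kcat :=
  @Presheaf Kcat wsec wsec_res _ _.
Next Obligation.
move=> y m; apply: wsec_eq; apply: functional_extensionality_dep => o /=.
by case: o => O oI oK f; rewrite /sl_push /= comp1m.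
Qed.
Next Obligation.
move=> x y z f g m; apply: wsec_eq.
apply: functional_extensionality_dep => o /=.
by case: o => O oI oK h; rewrite /sl_push /= -compA.
Qed.

End WeightedSections.
End Stacks.

(* Main.v *)
(* Over a connected family e in the domain of I, a section of S^I is a family
   (th_i), i in I(e), of sections of S such that th_i = th_j near the closed set
   of points where i and j are not separated: restriction of branches is
   surjective, and branches identified by a restriction are equivalent. The
   patching problem for S^I over e is solved by constructing the th_i one at a
   time. A new th_i is obtained by patching in S the data near the th_j already
   constructed on small neighbourhoods of the loci where i and j are not
   separated, and the i-th components of the given sections elsewhere.

   An arbitrary family y is exhausted by a sequence of closed sets, each
   covered by the previous one together with one family e as above. A solution
   near the n-th closed set is extended to the next one by solving over e the
   patching problem for the given sections and the solution already found, the
   former being used only away from the n-th closed set. As this needs no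
   smallness of e, the families e can be fixed in advance.

   Extension follows from Patching: extend the components of the given section
   over a small family around the image of the curve, and patch the result with
   arbitrary sections away from that image. *)
From mathcomp Require Import all_boot all_order all_algebra.
From mathcomp Require Import all_classical all_reals all_analysis.
Require Import Defs.
Set Implicit Arguments.
Unset Strict Implicit.
Unset Printing Implicit Defensive.
Import Order.TTheory GRing.Theory Num.Theory.
Import numFieldNormedType.Exports.
Local Open Scope classical_set_scope.
Local Open Scope ring_scope.

(** * Second countable regular spaces *)

Section Topology.
Variable T : topologicalType.

Lemma second_countable_seq : @second_countable T ->
  exists b : nat -> set T, (forall n, open (b n)) /\
    forall (x : T) U, nbhs x U -> exists n, b n x /\ b n `<=` U.
Proof.
case=> B /countable_injP[f fi] [Bo Bx].
(* As [f] is injective on [B], each union has at most one member; indices outside the image of [f]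
   give the empty set. *)
exists (fun n => \bigcup_(U in [set U | B U /\ f U = n]) U); split.
  by move=> n; apply: bigcup_open => U [/Bo].
move=> x U /Bx [V /= [BV Vx] VU]; exists (f V); split.
  by exists V.
move=> z [W [BW fW] Wz]; apply: VU.
by rewrite -(fi _ _ (mem_set BW) (mem_set BV) fW).
Qed.

Hypothesis reg : @regular_space T.

Lemma regular_basis (b : nat -> set T) :
  (forall (x : T) U, nbhs x U -> exists n, b n x /\ b n `<=` U) ->
  forall (x : T) U, nbhs x U -> exists n, b n x /\ closure (b n) `<=` U.
Proof.
move=> bP x U /reg [V Vx VU]; have [n [bx bV]] := bP _ _ Vx.
by exists n; split=> //; apply: subset_trans VU; exact: closureS.
Qed.

Hypothesis sc : @second_countable T.

(** Normality from regularity and a countable basis, by alternately subtracting closures of basic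
    sets. *)
Lemma normal_shrink (C O : set T) : closed C -> open O -> C `<=` O ->
  exists B, [/\ open B, C `<=` B & closure B `<=` O].
Proof.
move=> cC oO CO; have [b [bo bP]] := second_countable_seq sc.
have rb := regular_basis bP.
(* Basic sets of kind [g1] have closure inside [O], those of kind [g2] closure off [C]. Removing
   from each the closures of the other kind of no larger index makes [U] and [V] disjoint, while
   they still cover [C] and the complement of [O]. *)
pose g1 n := closure (b n) `<=` O; pose g2 n := closure (b n) `<=` ~` C.
pose F (g : nat -> Prop) n := \bigcup_(k in [set k | (k <= n)%N /\ g k]) closure (b k).
have cF g n : closed (F g n).
  apply: closed_bigcup => [|k _]; last exact: closed_closure.
  by apply: (@sub_finite_set _ _ `I_n.+1) => // k [].
pose U := \bigcup_(n in g1) (b n `\` F g2 n).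
pose V := \bigcup_(n in g2) (b n `\` F g1 n).
have oU : open U.
  by apply: bigcup_open => n _; apply: openI => //; exact: closed_openC.
have oV : open V.
  by apply: bigcup_open => n _; apply: openI => //; exact: closed_openC.
have UV : U `<=` ~` V.
  move=> x [n gn [bn Fn]] [m gm [bm Fm]].
  case: (leqP m n) => nm; first by apply: Fn; exists m => //; exact: subset_closure.
  by apply: Fm; exists n; [split=> //; exact: ltnW | exact: subset_closure].
exists U; split=> // [x Cx|].
  have [n [bx bO]] := rb x O (open_nbhs_nbhs (conj oO (CO _ Cx))).
  by exists n => //; split=> // -[k [_ gk] /gk].
move=> x Ux; apply: contrapT => Ox.
have clV : closed (~` V) by exact: open_closedC.
have : (~` V) x by apply: clV; apply: closureS Ux.
apply.
have [|n [bx bC]] := rb x (~` C).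
  apply: open_nbhs_nbhs; split; first exact: closed_openC.
  by move=> /CO.
by exists n => //; split=> // -[k [_ gk] /gk].
Qed.

End Topology.

(** * Exploded spaces and open embeddings *)

Section Embeddings.
Variable R : realType.
Implicit Types B C D : espace R.

Lemma near_continuous (T U : topologicalType) (f : T -> U) (x : T) (P : U -> Prop) :
  continuous f -> (\forall y \near f x, P y) -> \forall z \near x, P (f z).
Proof. by move=> /(_ x) fc; exact: fc. Qed.

Lemma set_val_range (T : Type) (U : set T) (x : set_type U) : U (set_val x).
Proof. by case: x => x xU; exact: set_mem. Qed.

Lemma set_val_continuous (T : topologicalType) (U : set T) :
  continuous (set_val : set_type U -> T).
Proof. by move=> x; exact: initial_continuous. Qed.

Lemma set_val_inj (T : Type) (U : set T) : injective (set_val : set_type U -> T).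
Proof. exact: val_inj. Qed.

Lemma set_val_lift (T : Type) (U : set T) (x : T) :
  U x -> exists y : set_type U, set_val y = x.
Proof. by move=> Ux; exists (exist _ x (mem_set Ux)). Qed.

(** An intrinsic form of [open_emb]: without an explicit inverse, the conditions pass directly to
    composites and factors. *)
Definition open_emb_spec B C (h : emor B C) : Prop :=
  [/\ injective h, forall O : set B, open O -> open (h @` O) &
      forall x f, germ x f -> exists F : C -> etr R,
        germ (h x) F /\ \forall y \near x, f y = F (h y)].

Lemma open_embP B C (h : emor B C) : open_emb h <-> open_emb_spec h.
Proof.
split=> [[U [f [g [oU fK gK fh]]]]|[hi ho hg]].
- have gh u : h (g u) = set_val u by rewrite -fh gK.
  split=> [x y xy|O oO|x k gk].
  + by apply: (can_inj fK); apply: set_val_inj; rewrite !fh.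
  + have : open (g @^-1` O) by apply: open_comp => // ? _; exact: efn_cont.
    case=> W oW WE; rewrite (_ : h @` O = W `&` U); first exact: openI.
    apply/seteqP; split=> [_ [x Ox <-]|c [Wc Uc]].
      split; last by rewrite -fh; exact: set_val_range.
      have : (g @^-1` O) (f x) by rewrite /= fK.
      by rewrite -WE /= fh.
    have [u uc] := set_val_lift Uc; exists (g u); last by rewrite gh.
    by have : (set_val @^-1` W) u; [rewrite /= uc | rewrite WE].
  + have : germ (f x) (k \o g) by apply: efn_germ; rewrite fK.
    case=> F [gF kF]; exists F; split; first by rewrite -fh.
    have := near_continuous (@efn_cont _ _ _ f) kF.
    by apply: filterS => y /=; rewrite fK fh.
- have oU : open (range h) by apply: ho; exact: openT.
  have fc : continuous (fun x => exist _ (h x) (mem_set (imageT h x)) : set_type (range h)).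
    apply/continuousP => O [W oW <-].
    rewrite (_ : _ @^-1` _ = h @^-1` W) //.
    by apply: open_comp => // ? _; exact: efn_cont.
  pose f0 x : sub (range h) := exist _ (h x) (mem_set (imageT h x)).
  have fg x k : germ (f0 x) k -> germ x (k \o f0).
    case=> F [gF kF]; apply: (@germ_ext _ _ x (F \o h)); first exact: efn_germ.
    by have := near_continuous fc kF; apply: filterS => y /= ->.
  have hinv (u : sub (range h)) : exists x, h x = set_val u.
    by have [x _ <-] := set_val_range u; exists x.
  pose g0 u : B := sval (cid (hinv u)).
  have g0E u : h (g0 u) = set_val u by exact: svalP (cid (hinv u)).
  have g0f x : g0 (f0 x) = x by apply: hi; rewrite g0E.
  have f0g u : f0 (g0 u) = u by apply: set_val_inj; exact: g0E.
  have g0c : continuous g0.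
    apply/continuousP => O oO; exists (h @` O); first exact: ho.
    apply/seteqP; split=> [u /= [x Ox xu]|u Ou].
      by rewrite /preimage /= (_ : g0 u = x) //; apply: hi; rewrite g0E.
    by exists (g0 u).
  have gg u k : germ (g0 u) k -> germ u (k \o g0).
    move=> /hg [F [gF kF]]; exists F; split; first by rewrite -g0E.
    by have := near_continuous g0c kF; apply: filterS => v /= ->; rewrite g0E.
  exists (range h), (@EMor _ B (sub (range h)) f0 fc fg).
  by exists (@EMor _ (sub (range h)) B g0 g0c gg); split.
Qed.

Lemma open_emb_inj B C (h : emor B C) : open_emb h -> injective h.
Proof. by move=> /open_embP[]. Qed.

Lemma open_emb_open B C (h : emor B C) O : open_emb h -> open O -> open (h @` O).
Proof. by move=> /open_embP[_ + _]; apply. Qed.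

Lemma open_emb_range B C (h : emor B C) : open_emb h -> open (range h).
Proof. by move=> /open_emb_open; apply; exact: openT. Qed.

Lemma emor_open B C (h : emor B C) O : open O -> open (h @^-1` O).
Proof. by move=> oO; apply: open_comp => // ? _; exact: efn_cont. Qed.

Lemma emor_compE B C D (h : emor C D) (k : emor B C) g :
  emor_comp h k = g -> forall x, h (k x) = g x.
Proof. by move=> <-. Qed.

Lemma open_emb_comp B C D (h : emor C D) (k : emor B C) :
  open_emb h -> open_emb k -> open_emb (emor_comp h k).
Proof.
move=> /open_embP[hi ho hg] /open_embP[ki ko kg]; apply/open_embP; split.
- by move=> x y /hi /ki.
- by move=> O /ko /ho; rewrite image_comp.
- move=> x f /kg [F [/hg [G [gG FG]] fF]]; exists G; split=> //.
  have := near_continuous (@efn_cont _ _ _ k) FG; apply: filterS2 fF => y /= -> ->; by [].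
Qed.

Lemma open_emb_cancel B C D (h : emor C D) (k : emor B C) :
  open_emb h -> open_emb (emor_comp h k) -> open_emb k.
Proof.
move=> /open_embP[hi ho hg] /open_embP[ki ko kg]; apply/open_embP; split.
- by move=> x y xy; apply: ki; rewrite /= xy.
- move=> O oO; rewrite (_ : k @` O = h @^-1` ((h \o k) @` O)).
    by apply: emor_open; exact: ko.
  apply/seteqP; split=> [_ [x Ox <-]|c [x Ox /hi <-]]; by exists x.
- move=> x f /kg [F [gF fF]]; exists (F \o h); split=> //.
  exact: efn_germ.
Qed.

(** The factor [k] is [g] followed by the inverse of [h] on its range. It is continuous because [h]
    is open; a germ on [B] is locally [F \o h], so its pullback by [k] is locally [F \o g]. *)
Lemma open_emb_factor B C D (h : emor B C) (g : emor D C) :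
  open_emb h -> range g `<=` range h -> exists k, emor_comp h k = g.
Proof.
move=> /open_embP[hi ho hg] gh.
have kx d : exists b, h b = g d by have [b _ bd] := gh _ (imageT g d); exists b.
pose k d := sval (cid (kx d)).
have kE d : h (k d) = g d := svalP (cid (kx d)).
have kc : continuous k.
  apply/continuousP => O oO; rewrite (_ : _ @^-1` _ = g @^-1` (h @` O)).
    by apply: emor_open; exact: ho.
  apply/seteqP; split=> [d /= Ok|d /= [b Ob bd]]; first by exists (k d).
  by rewrite (_ : k d = b) //; apply: hi; rewrite kE.
have kg d f : germ (k d) f -> germ d (f \o k).
  move=> /hg [F [gF fF]]; apply: (@germ_ext _ _ d (F \o g)).
    by apply: efn_germ; rewrite -kE.
  by have := near_continuous kc fF; apply: filterS => e /= ->; rewrite kE.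
by exists (@EMor _ D B k kc kg); apply: emor_eq; apply/funext => d /=; rewrite kE.
Qed.

Program Definition incl B (U : set B) : emor (sub U) B :=
  @EMor R (sub U) B (set_val : set_type U -> B) _ _.
Next Obligation. by move=> B U x; exact: initial_continuous. Qed.
Next Obligation. by move=> B U x f gf; exists f; split=> //; apply: filterS filterT. Qed.

Lemma open_emb_incl B (U : set B) : open U -> open_emb (incl U).
Proof.
move=> oU; exists U, (emor_id (sub U)), (emor_id (sub U)); split=> //.
Qed.

Lemma range_incl B (U : set B) : range (incl U) = U.
Proof.
apply/seteqP; split=> [_ [u _ <-]|x Ux]; first exact: set_val_range.
by have [u ux] := set_val_lift Ux; exists u.
Qed.

Lemma second_countable_sub B (U : set B) :
  @second_countable B -> @second_countable (sub U).
Proof.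
case=> S cS [So Sx]; exists [set (set_val : set_type U -> B) @^-1` A | A in S].
  by apply: card_le_trans cS; exact: card_image_le.
split=> [_ [A /So oA <-]|x V]; first by exists A.
rewrite nbhsE => -[_ [[W oW <-] /= Wx] WV].
have [A /= [SA Ax] AW] := Sx _ _ (open_nbhs_nbhs (conj oW Wx)).
exists (set_val @^-1` A); first by split=> //; exists A.
by move=> y Ay; apply: WV; exact: AW.
Qed.

Lemma regular_sub B (U : set B) : @regular_space B -> @regular_space (sub U).
Proof.
move=> reg x V; rewrite {1}nbhsE => -[_ [[W oW <-] /= Wx] WV].
have [A Ax AW] := reg _ _ (open_nbhs_nbhs (conj oW Wx)).
exists (set_val @^-1` A); first exact: (near_continuous (@set_val_continuous B U) Ax).
move=> y Ay; apply: WV; apply: AW => /= N Ny.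
have [z [Az Nz]] := Ay _ (near_continuous (@set_val_continuous _ U) Ny).
by exists (set_val z).
Qed.

(** A chart [h] of [B] restricts to the part [W'] of the model that it sends into [U], and this
    restriction factors through [sub U]. *)
Lemma is_emanifold_sub B (U : set B) : open U ->
  is_emanifold B -> is_emanifold (sub U).
Proof.
move=> oU [sc reg ch]; split; [exact: second_countable_sub|exact: regular_sub|].
move=> x; have [n [m [P [W [h [[oW hemb] [w _ wx]]]]]]] := ch (set_val x).
pose W' := set_val @` (h @^-1` U).
have oW' : open W'.
  apply: (open_emb_open (open_emb_incl oW)); exact: emor_open.
have [k kE] : exists k, emor_comp (incl W) k = incl W'.
  apply: open_emb_factor; first exact: open_emb_incl.
  by rewrite !range_incl => _ [v _ <-]; exact: set_val_range.
have kemb : open_emb k.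
  by apply: (@open_emb_cancel _ _ _ (incl W)); rewrite ?kE; exact: open_emb_incl.
have hU v : U (h (k v)).
  have [v' hv'U v'E] := set_val_range v.
  suff -> : k v = v' by [].
  apply: set_val_inj; rewrite [RHS]v'E.
  exact: (emor_compE kE v).
have [h' h'E] : exists h', emor_comp (incl U) h' = emor_comp h k.
  apply: open_emb_factor; first exact: open_emb_incl.
  by rewrite range_incl => _ [v _ <-] /=; exact: hU.
exists n, m, P, W', h'; split.
  split=> //; apply: (@open_emb_cancel _ _ _ (incl U)); first exact: open_emb_incl.
  by rewrite h'E; exact: open_emb_comp.
have W'w : W' (set_val w) by exists w => //=; rewrite wx; exact: set_val_range.
have [v vw] := set_val_lift W'w; exists v => //; apply: set_val_inj.
transitivity (h (k v)); first exact: (emor_compE h'E v).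
rewrite -wx; congr (h _); apply: set_val_inj; rewrite -vw.
exact: (emor_compE kE v).
Qed.

End Embeddings.

(** * The one-point exploded manifold *)

Section Point.
Variable R : realType.

Lemma point_polytope_int : interior [set u : 'rV[R]_0 | all (fun c : monomial R 0 * bool =>
    if c.2 then 0 < mono_trop c.1 u else 0 <= mono_trop c.1 u) [::]] !=set0.
Proof. by exists 0; apply: filterS filterT. Qed.

Definition point_polytope : polytope R 0 := Polytope point_polytope_int.

(* Curves are the probes in the axioms of [I]; they are obtained by lifting
   maps from this one-point model. *)
Definition point_space : espace R := model 0 point_polytope.

Lemma point_spaceP (p q : point_space) : p = q.
Proof.
case: p q => [x z zP] [x' z' z'P].
have xx : x = x' by apply/rowP => -[].
have zz : z = z' by apply/rowP => -[].
by subst; congr Mpt; exact: Prop_irrelevance.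
Qed.

Lemma pset_point (u : 'rV[R]_0) : pset point_polytope u.
Proof. by []. Qed.

Definition the_point : point_space :=
  @Mpt R 0 0 point_polytope 0 (\row_i etr_t 0) (pset_point _).

Lemma C1on_point N (g : point_space -> R) : C1on N g.
Proof.
have cg (h : point_space -> R) : h = cst (h the_point).
  by apply/funext => p; rewrite (point_spaceP p the_point).
split=> [Vs p _|Vs q u l delta _ _ l0 _ _].
  split; first by rewrite (cg (Dvs Vs g)); exact: cst_continuous.
  by move=> V; rewrite (cg (Dvs Vs g)); exact: derivable_cst.
exists [::], 0; split=> //; apply: filterS filterT => p _ _.
case: l l0 => // a l _ /=.
by rewrite /Delta (point_spaceP (shift a p) p) subrr normr0 mul0r.
Qed.

(** A function pulled back from [B] is a constant [c t^a], which has the local form of a section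
    with trivial exponent [alpha]. *)
Lemma point_map (B : espace R) (x : B) :
  exists h : emor point_space B, forall p, h p = x.
Proof.
have gh f : germ x f -> forall p : point_space, germ p (f \o (fun=> x)).
  move=> gf p; exists setT, (0, expo (f x)), (fun=> coef (f x)); split=> //.
  - exact: openT.
  - exact: C1on_point.
  - exact: C1on_point.
  - move=> q _ /=; rewrite /mono_coef /mono_trop !big_ord0 mulr1 addr0; by [].
have hc : continuous (fun _ : point_space => x) by exact: cst_continuous.
by exists (@EMor R point_space B (fun=> x) hc (fun p f gf => gh f gf p)).
Qed.

Lemma is_emanifold_point : is_emanifold point_space.
Proof.
split.
- exists [set setT]; first exact: countable1.
  split=> [_ ->|p A Ap]; first exact: openT.
  exists setT => //= q _; rewrite (point_spaceP q p); exact: nbhs_singleton.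
- move=> p A Ap; exists setT; first exact: filterT.
  move=> q _; rewrite (point_spaceP q p); exact: nbhs_singleton.
- move=> p; exists 0%N, 0%N, point_polytope, setT, (incl setT); split.
    by split; [exact: openT|exact/open_emb_incl/openT].
  by rewrite range_incl.
Qed.

End Point.

(** * Families over open subspaces *)

Section StackGeometry.
Variables (R : realType) (X : stack R).
Local Notation F := (stF X).

Lemma smapM (x y z : X) (f : hom y z) (g : hom x y) t :
  smap (f \c g) t = smap f (smap g t).
Proof. by rewrite /smap fmapM. Qed.

Lemma open_preimage (x y : X) (f : hom x y) V : open V -> open (smap f @^-1` V).
Proof. exact: emor_open. Qed.

Lemma open_sub_range (x y : X) (u : hom x y) : open_sub u -> open (range (smap u)).
Proof. exact: open_emb_range. Qed.

Lemma open_sub_inj (x y : X) (u : hom x y) : open_sub u -> injective (smap u).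
Proof. exact: open_emb_inj. Qed.

Lemma open_sub_comp (x y z : X) (f : hom y z) (g : hom x y) :
  open_sub f -> open_sub g -> open_sub (f \c g).
Proof. by rewrite /open_sub /smap fmapM; exact: open_emb_comp. Qed.

Lemma open_sub_cancel (x y z : X) (f : hom y z) (g : hom x y) :
  open_sub f -> open_sub (f \c g) -> open_sub g.
Proof. by rewrite /open_sub /smap fmapM; exact: open_emb_cancel. Qed.

(** Eliminating [lies_over] into a predicate on all morphisms to [F y] transports properties of [f]
    without casts along an equality of objects. *)
Lemma lies_over_ind (x y : X) (phi : hom x y) (B : expl R) (f : hom B (F y))
    (Q : forall B : expl R, hom B (F y) -> Prop) :
  lies_over phi f -> Q B f -> Q (F x) (fmap F phi).
Proof. by case. Qed.

Lemma lift_open (y : X) (V : set (space y)) : open V ->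
  exists (x : X) (u : hom x y), open_sub u /\ range (smap u) = V.
Proof.
move=> oV.
pose B : expl R := exist _ (sub V) (is_emanifold_sub oV (svalP (F y))).
pose f : hom B (F y) := incl V.
have [x [phi phif]] := st_lift f; exists x, phi.
pose Q (B' : expl R) (g : hom B' (F y)) :=
  open_emb (g : emor (sval B') (space y)) /\ range (g : emor (sval B') (space y)) = V.
apply: (lies_over_ind (Q := Q) phif); split; first exact: open_emb_incl.
exact: range_incl.
Qed.

(** The factorization exists on the underlying spaces and lifts because [st_cart] makes every
    morphism cartesian. *)
Lemma open_sub_factor (x y z : X) (u : hom x y) (f : hom z y) : open_sub u ->
  (forall t, range (smap u) (smap f t)) -> exists k, u \c k = f.
Proof.
move=> uo fu.
have [|h hE] := @open_emb_factor _ _ _ _ (smap u) (smap f) uo.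
  by move=> _ [t _ <-].
have [k [[_ kE] _]] := @st_cart _ X _ _ _ u f h hE.
by exists k.
Qed.

Lemma open_sub_mono (x y z : X) (u : hom x y) (k k' : hom z x) : open_sub u ->
  u \c k = u \c k' -> k = k'.
Proof.
move=> uo kk'.
have kE : fmap F k = fmap F k'.
  apply: emor_eq; apply/funext => t; apply: (open_sub_inj uo).
  by rewrite -!smapM kk'.
have [|k0 [_ k0E]] := @st_cart _ X _ _ _ u (u \c k') (fmap F k').
  by rewrite fmapM.
by rewrite -(k0E k) // -(k0E k').
Qed.

(** The last clause holds because the one-point model maps to every point of every space. It lets
    two curves at the same point be compared by pulling back to a third. *)
Lemma curve_at (y : X) (p : space y) : exists (f : X) (c : hom f y),
  [/\ is_curve f, forall t, smap c t = p &
      forall (f' : X) (c' : hom f' y), range (smap c') p ->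
        exists k, c' \c k = c].
Proof.
pose B : expl R := exist _ (point_space R) (is_emanifold_point R).
have [h hp] := point_map p.
have [f [c cf]] := @st_lift _ X _ B h; exists f, c.
pose Q (B' : expl R) (g : hom B' (F y)) := [/\ is_point (sval B'),
  forall t : sval B', (g : emor _ _) t = p &
  forall (C : espace R) (x : C), exists k : emor (sval B') C, forall t, k t = x].
have [|fp cp fk] := @lies_over_ind _ _ _ _ _ Q cf.
  split=> //; last by move=> C x; exact: point_map.
  by exists (the_point R) => q; exact: point_spaceP.
split=> // f' c' [x _ xp]; have [k kx] := fk _ x.
have [|k' [[_ k'E] _]] := @st_cart _ X _ _ _ c' c k.
  by apply: emor_eq; apply/funext => t /=; rewrite cp kx.
by exists k'.
Qed.

Lemma open_pullback (x y z : X) (u : hom x y) (phi : hom z y) : open_sub u ->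
  exists (w : X) (p1 : hom w z) (p2 : hom w x), [/\ open_sub p1,
    phi \c p1 = u \c p2 & range (smap p1) = smap phi @^-1` range (smap u)].
Proof.
move=> uo; have [w [p1 [p1o p1r]]] := lift_open (open_preimage phi (open_sub_range uo)).
have [|p2 p2E] := @open_sub_factor _ _ _ u (phi \c p1) uo.
  by move=> t; have := imageT (smap p1) t; rewrite p1r /= smapM.
by exists w, p1, p2.
Qed.

Variable K : Kcategory X.

Lemma inK_open (x y : X) (u : hom x y) : open_sub u -> inK K y -> inK K x.
Proof.
move=> uo yK t; have [U [v [i [q [vo [s _ st]] qo]]]] := yK (smap u t).
have [w [p1 [p2 [p1o p12 p1r]]]] := open_pullback v uo.
exists w, p2, i, (q \c p1); split; [| |exact: (open_sub_comp qo p1o)].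
  by apply: (@open_sub_cancel _ _ _ u) => //; rewrite -p12; exact: open_sub_comp.
have [r _ rs] : range (smap p1) s by rewrite p1r /=; exists t.
exists r => //; apply: (open_sub_inj uo).
by rewrite -smapM -p12 smapM rs.
Qed.

Lemma open_pullbackK (x y z : Kcat K) (u : hom x y) (phi : hom z y) :
  open_sub (u : @hom X _ _) ->
  exists (w : Kcat K) (p1 : hom w z) (p2 : hom w x),
    [/\ is_pullback phi u p1 p2, open_sub (p1 : @hom X _ _) &
     range (smap (p1 : @hom X _ _)) =
       smap (phi : @hom X _ _) @^-1` range (smap (u : @hom X _ _))].
Proof.
move=> uo; have [w [p1 [p2 [p1o p12 p1r]]]] := open_pullback (phi : @hom X _ _) uo.
exists (exist _ w (inK_open p1o (svalP z))), p1, p2; split=> //; split=> // v a b ab.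
have [|k kE] := @open_sub_factor _ _ _ p1 (a : @hom X _ _) p1o.
  by move=> t; rewrite p1r /=; exists (smap (b : @hom X _ _) t) => //; rewrite -!smapM;
      congr (smap _ t).
have kb : (p2 : @hom X _ _) \c k = b.
  apply: (open_sub_mono uo); rewrite compA -p12 -compA kE; exact: ab.
exists k; split=> // k' [k'E _].
by apply: (open_sub_mono p1o); rewrite kE.
Qed.

End StackGeometry.

(** * Germs of sections and gluing over pieces *)

Section Sections.
Variables (R : realType) (X : stack R) (K : Kcategory X).
Variables (I : branched_cover K) (S : presheaf (Kcat K)).

Local Notation "x ~> y" := (@hom X (sval (x : Kcat K)) (sval (y : Kcat K))) (at level 70).

(* A slice of y is a piece with a map to y. *)
Record piece := Piece { pob : X; piece_I : wdom I pob; piece_K : inK K pob }.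
Arguments piece_K _ _ : clear implicits.
Definition pfam (o : piece) : Kcat K := exist _ (pob o) (piece_K o).
Definition pdom (o : piece) : full (wdom I) := exist _ (pob o) (piece_I o).

Coercion pfam : piece >-> ob.

Definition branches (o : piece) : wset := wI I (pdom o).

Definition resb (o1 o2 : piece) (a : o1 ~> o2) : branches o2 -> branches o1 :=
  wfn (@cmap _ _ I (pdom o1) (pdom o2) a).

Definition branch_at (g : full (wdom I)) (o : piece) (c : @hom X (sval g) (pob o)) :
    branches o -> wI I g :=
  wfn (@cmap _ _ I g (pdom o) c).

Definition restr (x y : Kcat K) (f : x ~> y) : S y -> S x := @res _ S x y f.

Lemma restr1 (x : Kcat K) s : restr (idm (sval x)) s = s :> S x.
Proof. exact: (@res1 _ S x s). Qed.

Lemma restrM (x y z : Kcat K) (f : y ~> z) (g : x ~> y) s :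
  restr (x := x) (y := z) (f \c g) s = restr g (restr f s).
Proof. exact: (@resM _ S x y z f g s). Qed.

Lemma resb1 (o : piece) i : resb (idm (pob o)) i = i :> branches o.
Proof. by rewrite /resb (@cmap1 _ _ I (pdom o)). Qed.

Lemma resbM (o1 o2 o3 : piece) (f : o2 ~> o3) (g : o1 ~> o2) i :
  resb (o1 := o1) (o2 := o3) (f \c g) i = resb g (resb f i).
Proof. by rewrite /resb (@cmapM _ _ I (pdom o1) (pdom o2) (pdom o3) f g). Qed.

Lemma branch_atM (h : full (wdom I)) (o1 o2 : piece) (f : o1 ~> o2) (g :
    @hom X (sval h) (pob o1)) i :
  branch_at (g := h) (o := o2) (f \c g) i = branch_at g (resb f i).
Proof. by rewrite /branch_at /resb (@cmapM _ _ I h (pdom o1) (pdom o2) f g). Qed.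

(** The points at which the two sections have the same germ. *)
Definition agree_near (x : Kcat K) (s s' : S x) : set (space (sval x)) :=
  [set p | exists (U : Kcat K) (u : U ~> x),
    [/\ open_sub u, range (smap u) p & restr u s = restr u s']].

Lemma agree_near_open x (s s' : S x) : open (agree_near s s').
Proof.
rewrite openE => p [U [u [uo up us]]].
apply: filterS (open_nbhs_nbhs (conj (open_sub_range uo) up)) => q uq.
by exists U, u.
Qed.

Lemma agree_near_refl x (s : S x) p : agree_near s s p.
Proof.
have [U [u [uo ur]]] := lift_open (@openT (space (sval x))).
by exists (exist _ U (inK_open uo (svalP x))), u; rewrite ur.
Qed.

Lemma agree_near_sym x (s s' : S x) p : agree_near s s' p -> agree_near s' s p.
Proof. by case=> U [u [uo up us]]; exists U, u. Qed.

Lemma agree_near_pull (x y : Kcat K) (phi : x ~> y) s s' p :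
  agree_near s s' (smap phi p) -> agree_near (restr phi s) (restr phi s') p.
Proof.
case=> U [u [uo up us]].
have [W [p1 [p2 [p1o p12 p1r]]]] := open_pullback phi uo.
exists (exist _ W (inK_open p1o (svalP x))), p1; split=> //; first by rewrite p1r.
by rewrite -!restrM p12 !(@restrM _ U) us.
Qed.

Lemma agree_near_push (x y : Kcat K) (u : x ~> y) s s' p : open_sub u ->
  agree_near (restr u s) (restr u s') p -> agree_near s s' (smap u p).
Proof.
move=> uo [U [v [vo [q _ qp] vs]]]; exists U, (u \c v); split.
- exact: open_sub_comp.
- by exists q => //; rewrite smapM qp.
- by rewrite !restrM vs.
Qed.

Lemma agree_near_trans x (s1 s2 s3 : S x) p : agree_near s1 s2 p ->
    agree_near s2 s3 p -> agree_near s1 s3 p.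
Proof.
case=> U [u [uo [q _ qp] us]] E23.
have : agree_near (restr u s2) (restr u s3) q by apply: agree_near_pull; rewrite qp.
case=> W [w [wo [r _ rq] ws]]; exists W, (u \c w); split.
- exact: open_sub_comp.
- by exists r => //; rewrite smapM rq.
- by rewrite !restrM us ws.
Qed.

Hypothesis Ssheaf : is_sheaf S.

Lemma sheaf_local x (s s' : S x) : (forall p, agree_near s s' p) -> s = s'.
Proof.
move=> Ess'.
pose A := {U : Kcat K & {u : U ~> x | open_sub u /\ restr u s = restr u s'}}.
pose u (a : A) : @hom (Kcat K) (projT1 a) x := sval (projT2 a).
have [||s0 [_ s0u]] := @Ssheaf A x (fun a => projT1 a) u (fun a => res S (u a) s).
- split=> [a|p]; first by have [] := svalP (projT2 a).
  have [U [v [vo vp vs]]] := Ess' p.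
  by exists (existT _ U (exist _ v (conj vo vs))).
- by move=> a b z i j ij; rewrite -!resM ij.
- rewrite -(s0u s) // -(s0u s') // => a.
  by have [_ /esym] := svalP (projT2 a).
Qed.

(** With [agree_near_of_curve], this translates the neighbourhoods of a curve in [nu_sep] and
    [Extension] into germs at its image point. *)
Lemma agree_near_curve (x : Kcat K) (s s' : S x) (f : X) (c : hom f (sval x)) :
  is_curve f -> (forall t, agree_near s s' (smap c t)) ->
  exists (U : Kcat K) (u : U ~> x) (d : hom f (sval U)),
    [/\ open_sub u, u \c d = c & restr u s = restr u s'].
Proof.
case=> t0 t0P /(_ t0) [U [u [uo up us]]].
have [|d dE] := @open_sub_factor _ _ _ _ _ u c uo.
  by move=> t; rewrite (t0P t).
by exists U, u, d.
Qed.

Lemma agree_near_of_curve (x : Kcat K) (s s' : S x) (f : X) (c : hom f (sval x))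
  (U : Kcat K) (u : U ~> x) (d : hom f (sval U)) t :
  open_sub u -> u \c d = c -> restr u s = restr u s' -> agree_near s s' (smap c t).
Proof.
by move=> uo <- us; exists U, u; split=> //; exists (smap d t) => //; rewrite smapM.
Qed.

Definition over (y x : X) (V : set (space y)) (f : hom x y) : Prop :=
  forall t, V (smap f t).

Lemma over_comp (x y z : X) (V : set (space z)) (f : hom y z) (g : hom x y) :
  over V f -> over V (f \c g).
Proof. by move=> fV t; rewrite smapM; exact: fV. Qed.

Lemma over_preimage (x y z : X) (V : set (space z)) (f : hom y z) (g : hom x y) :
  over V (f \c g) <-> over (smap f @^-1` V) g.
Proof. by split=> gV t; have := gV t; rewrite smapM. Qed.

(** Pieces form a basis for the topology of a family: [wdom_cover] is applied to the open subfamily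
    over [V]. *)
Lemma small_piece (y : Kcat K) (V : set (space (sval y))) p : open V -> V p ->
  exists (o : piece) (u : o ~> y), [/\ open_sub u, range (smap u) p & over V u].
Proof.
move=> oV Vp; have [W [w [wo wV]]] := lift_open oV.
have WK := inK_open wo (svalP y).
have [q _ qp] : range (smap w) p by rewrite wV.
have [U [u [uo [r _ rq] UI]]] := wdom_cover I WK q.
exists (Piece UI (inK_open uo WK)), (w \c u); split.
- exact: open_sub_comp.
- by exists r => //; rewrite smapM rq.
- move=> t; rewrite smapM -[V]wV; exact: imageT.
Qed.

Lemma sheaf_local_pieces (x : Kcat K) (s s' : S x) :
  (forall p, exists (o : piece) (u : o ~> x),
    [/\ open_sub u, range (smap u) p & restr u s = restr u s']) -> s = s'.
Proof. by move=> H; apply: sheaf_local => p; have [ o [u hu]] :=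
    H p; exists (pfam o), u. Qed.

(** Sheaf gluing when values are given on pieces only, for a class [Q] of maps stable under
    precomposition. Maps in [Q] may fail to be open; the cover consists of open ones. *)
Lemma sheaf_basis_glue (x : Kcat K) (Q : forall o : piece, o ~> x -> Prop)
    (t : forall o : piece, o ~> x -> S (pfam o)) :
  (forall (o o' : piece) (a : o' ~> o) (f : o ~> x), Q o f ->
     Q o' (f \c a) /\ restr a (t o f) = t o' (f \c a)) ->
  (forall p, exists (o : piece) (u : o ~> x),
     [/\ open_sub u, range (smap u) p & Q o u]) ->
  exists s : S x, forall (o : piece) (f : o ~> x), Q o f -> restr f s = t o f.
Proof.
move=> Qt Qc.
pose A := {o : piece & {u : o ~> x | open_sub u /\ Q o u}}.
pose u (a : A) : @hom (Kcat K) (pfam (projT1 a)) x := sval (projT2 a).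
have [||s [st _]] := @Ssheaf A x (fun a => pfam (projT1 a)) u (fun a => t _ (u a)).
- split=> [a|p]; first by have [] := svalP (projT2 a).
  have [ o [v [vo vp vQ]]] := Qc p.
  by exists (existT _ o (exist _ v (conj vo vQ))).
- move=> a b z i j ij; have [_ aQ] := svalP (projT2 a).
  have [_ bQ] := svalP (projT2 b).
  (* The overlap [z] is an arbitrary family, so the two restrictions are compared on pieces covering
     it. *)
  apply: sheaf_local_pieces => p; have [ o [w [wo wp _]]] :=
      small_piece openT (Logic.I : setT p).
  exists o, w; split=> //.
  rewrite -[res S i _]/(restr i _) -[res S j _]/(restr j _) -!restrM.
  rewrite (Qt _ _ _ _ aQ).2 (Qt _ _ _ _ bQ).2 !compA; congr (t o _).
  by congr (_ \c _).
exists s => o f fQ; apply: sheaf_local_pieces => p.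
have [ o' [v [vo vp vQ]]] := Qc (smap f p).
have [W [p1 [p2 [p1o p12 p1r]]]] := open_pullback f vo.
pose WK : Kcat K := exist _ W (inK_open p1o (piece_K o)).
have [q _ qp] : range (smap p1) p by rewrite p1r.
have [ o'' [w [wo [r _ rq] _]]] := @small_piece WK setT q openT Logic.I.
exists o'', (p1 \c w); split.
- exact: open_sub_comp.
- by exists r => //; rewrite smapM rq.
rewrite (Qt _ _ _ _ fQ).2 -restrM compA p12 -compA (@restrM _ o').
have -> : restr v s = t o' v by exact: (st (existT _ o' (exist _ v (conj vo vQ)))).
exact: (Qt _ _ _ _ vQ).2.
Qed.

End Sections.

(** * Partially defined weighted branched sections *)

Section PartialSections.
Variables (R : realType) (X : stack R) (K : Kcategory X).
Variables (I : branched_cover K) (S : presheaf (Kcat K)).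

Local Notation "x ~> y" := (@hom X (sval (x : Kcat K)) (sval (y : Kcat K))) (at level 70).
Local Notation piece := (piece I).

(* A section over an open subset V of a family y is encoded as a total function
   on the pairs (o, f : o -> y); only its values at the f with image in V are
   meaningful. *)
Definition presec (y : Kcat K) := forall (o : piece) (f : o ~> y), branches o -> S (pfam o).

Definition section_on (y : Kcat K) (V : set (space (sval y))) (m : presec y) : Prop :=
  (forall (o1 o2 : piece) (a : o1 ~> o2) (f : o2 ~> y), over V f ->
     forall i, restr a (m o2 f i) = m o1 (f \c a) (resb a i)) /\
  (forall (o : piece) (f : o ~> y), over V f ->
     forall i j (g : full (wdom I)) (c : @hom X (sval g) (pob o)),
     is_curve (sval g) -> weq (branch_at c i) (branch_at c j) ->
     forall t, agree_near (m o f i) (m o f j) (smap c t)).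

Definition vals (y : Kcat K) (n : wsec I S y) : presec y :=
  fun o f i => nu n (o := @Slice _ _ _ _ y (pob o) (piece_I o) (@piece_K _ _ _ _ o) f) i.

Lemma section_on_vals y V (n : wsec I S y) : section_on V (vals n).
Proof.
split=> [ o1 o2 a f _ i|o f _ i j g c gc ij t].
  by apply: (nu_nat n (o1 := Slice (piece_I o1) (@piece_K _ _ _ _ o1) (f \c a))
    (o2 := Slice (piece_I o2) (@piece_K _ _ _ _ o2) f)).
pose os := @Slice _ _ _ _ y (pob o) (piece_I o) (@piece_K _ _ _ _ o) f.
have [|U [u [d [uo ud us]]]] := @nu_sep _ _ _ _ _ _ n os i j g c gc.
  by rewrite /separated => /negP; apply.
exact: (agree_near_of_curve (x := pfam o) t uo ud us).
Qed.

Lemma to_wsec y (m : presec y) : section_on setT m ->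
  exists n : wsec I S y, forall o f i, vals n (o := o) f i = m o f i.
Proof.
case=> mn ms.
pose nu0 (o : slice I y) : wI I (slI o) -> S (slK o) :=
  m (Piece (sl_I o) (@sl_K _ _ _ _ _ o)) (sl_map o).
have nu_nat0 (o1 o2 : slice I y) (a : hom (sl_ob o1) (sl_ob o2)) :
    sl_map o2 \c a = sl_map o1 -> forall i : wI I (slI o2),
    res S (a : hom (slK o1) (slK o2)) (nu0 _ i) =
      nu0 _ (cmap I (a : hom (slI o1) (slI o2)) i).
  move=> oa i; rewrite /nu0 -oa.
  exact: (mn (Piece (sl_I o1) (@sl_K _ _ _ _ _ o1)) (Piece (sl_I o2) (@sl_K _ _ _ _ _
      o2)) a).
have nu_sep0 (o : slice I y) (i j : wI I (slI o)) (f : full (wdom I))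
    (c : hom f (slI o)) : is_curve (sval f) -> ~ separated c i j ->
    exists (U : Kcat K) (u : hom U (slK o)) (d : hom (sval f) (sval U)),
      [/\ open_sub (u : @hom X _ _), (u : @hom X _ _) \c d = c &
          res S u (nu0 _ i) = res S u (nu0 _ j)].
  move=> fc /negP; rewrite negbK => ij.
  pose o' := Piece (sl_I o) (@sl_K _ _ _ _ _ o).
  apply: (@agree_near_curve _ _ _ S (pfam o') (nu0 o i) (nu0 o j)) => // t.
  exact: (ms o' (sl_map o) (fun _ => Logic.I) i j f c fc ij t).
exists (WSec nu_nat0 nu_sep0) => -[ o oI oK] f i; by [].
Qed.

Lemma wsec_ext y (n n' : wsec I S y) :
  (forall o f i, vals n (o := o) f i = vals n' f i) -> n = n'.
Proof.
move=> nn'; apply: wsec_eq; apply: functional_extensionality_dep => -[ o oI oK f].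
by apply/funext => i; exact: (nn' (Piece oI oK) f i).
Qed.

Lemma section_on_sub y (V W : set (space (sval y))) m : W `<=` V -> section_on V m ->
    section_on W m.
Proof.
move=> WV [mn ms]; split=> [ o1 o2 a f fW|o f fW]; [apply: mn|apply: ms] => t;
  exact/WV/fW.
Qed.

Definition pull (x y : Kcat K) (phi : x ~> y) (m : presec y) : presec x :=
  fun o f => m o (phi \c f).

Lemma section_on_pull x y (phi : x ~> y) V m :
  section_on V m -> section_on (smap phi @^-1` V) (pull phi m).
Proof.
case=> mn ms; split=> [ o1 o2 a f fV i| o f fV].
  by rewrite /pull compA; apply: mn; apply/over_preimage.
by apply: ms; apply/over_preimage.
Qed.

Hypothesis Ssheaf : is_sheaf S.
Hypothesis Sinh : forall x : Kcat K, inhabited (S x).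

(** For fixed [f] and branch [i], the values of [mu b] at the restrictions of [i] to pieces over a
    single [W b] are glued in [S]. At an [f] not over the union the value is arbitrary. *)
Lemma glue_presections (B : Type) (y : Kcat K) (W : B -> set (space (sval y)))
    (mu : B -> presec y) :
  (forall b, open (W b)) -> (forall b, section_on (W b) (mu b)) ->
  (forall b b' (o : piece) (f : o ~> y), over (W b) f -> over (W b') f ->
     forall i, mu b o f i = mu b' o f i) ->
  exists m : presec y, section_on [set p | exists b, W b p] m /\
    forall b (o : piece) (f : o ~> y), over (W b) f -> forall i, m o f i = mu b o f i.
Proof.
move=> Wo Ws Wa; set U := [set p | _].
have ex (o : piece) (f : o ~> y) (i : branches o) : exists s : S (pfam o), over U f ->
    forall b (w : piece) (a : w ~> o), over (W b) (f \c a) ->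
      restr a s = mu b w (f \c a) (resb a i).
  have [fU|nfU] := pselect (over U f); last by have [s] := Sinh (pfam o); exists s.
  pose Q (w : piece) (a : w ~> o) := exists b, over (W b) (f \c a).
  have tx (w : piece) (a : w ~> o) : exists s : S (pfam w), forall b,
      over (W b) (f \c a) -> s = mu b w (f \c a) (resb a i).
    have [[b ab]|na] := pselect (Q w a).
      by exists (mu b w (f \c a) (resb a i)) => b' ab'; exact: Wa.
    by have [s] := Sinh (pfam w); exists s => b ab; case: na; exists b.
  pose t (w : piece) (a : w ~> o) := sval (cid (tx w a)).
  have tE (w : piece) (a : w ~> o) b : over (W b) (f \c a) ->
      t w a = mu b w (f \c a) (resb a i) by exact: (svalP (cid (tx w a))).
  have [||s sE] := @sheaf_basis_glue _ _ _ I S Ssheaf (pfam o) Q t.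
  - move=> w w' a g [b gb]; have gb' := over_comp a gb.
    split; first by exists b; rewrite compA.
    rewrite (tE _ _ _ gb) (Ws b).1 // (tE _ _ b) ?compA // -resbM; by [].
  - move=> p; have [b bp] := fU p.
    have [ w [u [uo up ub]]] := small_piece I (open_preimage f (Wo b)) bp.
    by exists w, u; split=> //; exists b; apply/over_preimage.
  exists s => _ b w a ab; rewrite sE; last by exists b.
  exact: tE.
pose m (o : piece) (f : o ~> y) i := sval (cid (ex o f i)).
have mE (o : piece) (f : o ~> y) i : over U f -> forall b (w : piece) (a : w ~> o),
    over (W b) (f \c a) -> restr a (m o f i) = mu b w (f \c a) (resb a i).
  exact: (svalP (cid (ex o f i))).
have mW b (o : piece) (f : o ~> y) : over (W b) f -> forall i, m o f i = mu b o f i.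
  move=> fb i; have fU : over U f by move=> t; exists b.
  by have := mE o f i fU b o (idm (pob o)); rewrite restr1 resb1 compm1 => ->.
exists m; split=> //; split=> [ o1 o2 a f fU i|o f fU i j g c gc ij t].
- apply: (sheaf_local_pieces (I := I)) => // p; have [b bp] := fU (smap a p).
  have Wp : (smap (f \c a) @^-1` W b) p by rewrite /= smapM.
  have [ w [u [uo up ub]]] := small_piece I (open_preimage (f \c a) (Wo b)) Wp.
  have ub' : over (W b) ((f \c a) \c u) by apply/over_preimage.
  exists w, u; split=> //.
  rewrite -(@restrM _ _ _ _ _ o1) (mE _ _ _ fU b) ?compA //.
  by rewrite (mE _ _ _ (over_comp a fU) b) // resbM.
- have [b bp] := fU (smap c t).
  have [ w [u [uo up ub]]] := small_piece I (open_preimage f (Wo b)) bp.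
  have ub' : over (W b) (f \c u) by apply/over_preimage.
  have [|d dE] := @open_sub_factor _ _ _ _ _ u c uo.
    by case: gc => t0 t0P t'; rewrite (t0P t') -(t0P t).
  have ij' : weq (branch_at (o := w) d (resb u i)) (branch_at (o := w) d (resb u j)).
    by rewrite -!branch_atM dE.
  have := (Ws b).2 w (f \c u) ub' _ _ g d gc ij' t.
  rewrite -!(mE _ _ _ fU b) // => /(agree_near_push (y := pfam o) uo).
  by rewrite -smapM dE.
Qed.

Section Compatibility.
Variables (y : Kcat K) (A : Type) (V : A -> set (space (sval y))) (m : A -> presec y).
Arguments m _ _ _ _ : clear implicits.

(* [good W mu] is the conclusion of the Patching axiom for the data (V, m), seen
   only over W, so that solutions can be built one open set at a time. *)
Definition compat (z : Kcat K) (phi : z ~> y) (n : wsec I S z) : Prop :=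
  forall a (o : piece) (f : o ~> z), over (V a) (phi \c f) ->
    forall i, vals n f i = m a o (phi \c f) i.

Definition good (W : set (space (sval y))) (mu : presec y) : Prop :=
  forall (z : Kcat K) (phi : z ~> y) (n : wsec I S z), compat phi n ->
  forall (o : piece) (f : o ~> z), over W (phi \c f) ->
    forall i, vals n f i = mu o (phi \c f) i.

Lemma good_union (B : Type) (W : B -> set (space (sval y))) mu :
  (forall b, open (W b)) -> section_on [set p | exists b, W b p] mu ->
  (forall b, good (W b) mu) -> good [set p | exists b, W b p] mu.
Proof.
move=> Wo [mun _] Wg z phi n nc o f fW i.
apply: (sheaf_local_pieces (I := I)) => // p; have [b bp] := fW p.
have [ w [u [uo up ub]]] := small_piece I (open_preimage (phi \c f) (Wo b)) bp.
have ub' : over (W b) ((phi \c f) \c u) by apply/over_preimage.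
exists w, u; split=> //.
rewrite (section_on_vals setT n).1 // mun // (Wg b _ phi _ nc) ?compA //.
Qed.

End Compatibility.

End PartialSections.

(** * Separation of branches *)

Section WeightedSets.

Lemma weq_refl (A : wset) (i : A) : weq i i.
Proof. by have [] := @weqP A i i i. Qed.

Lemma weq_sym (A : wset) (i j : A) : weq i j -> weq j i.
Proof.
by move=> ij; have [_ /(_ ij)] := @weqP A i j i; rewrite weq_refl => <-.
Qed.

Lemma weq_trans (A : wset) (j i k : A) : weq i j -> weq j k -> weq i k.
Proof. by move=> ij; have [_ /(_ ij) ->] := @weqP A i j k. Qed.

(** An empty fibre would have measure zero, whereas every point has positive measure. *)
Lemma wmor_surj (A B : wset) (f : wmor A B) b : exists a, f a = b.
Proof.
apply: contrapT => nf; have := wfn_mu f b.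
rewrite big_pred0 => [b0|a]; first by have := wmu_gt0 b; rewrite -b0 ltxx.
by apply/eqP => fa; apply: nf; exists a.
Qed.

(** Morphisms reflect equivalence; an isomorphism also preserves it because its inverse reflects
    it. *)
Lemma iso_weq (A B : wcat) (f : hom A B) (i j : A) : is_iso f ->
  weq i j -> weq ((f : wmor A B) i) ((f : wmor A B) j).
Proof.
case=> g [gf _] ij; have gfi k : (g : wmor B A) ((f : wmor A B) k) = k.
  exact: (congr1 (fun h : wmor A A => h k) gf).
by apply: (@wfn_eq _ _ (g : wmor B A)); rewrite !gfi.
Qed.

End WeightedSets.

(** * The locus where two branches are not separated *)

Section Separation.
Variables (R : realType) (X : stack R) (K : Kcategory X).
Variables (I : branched_cover K).

Local Notation "x ~> y" := (@hom X (sval (x : Kcat K)) (sval (y : Kcat K))) (at level 70).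
Local Notation piece := (piece I).

Lemma is_connected_curve (f : X) : is_curve f -> is_connected (space f).
Proof.
case=> x xP; split; first by exists x.
rewrite (_ : setT = [set x]); first exact: connected1.
by apply/seteqP; split=> // z _; exact: xP.
Qed.

Lemma wdom_curve (f O : X) (c : hom f O) : is_curve f -> wdom I O -> wdom I f.
Proof. by move=> /is_connected_curve fc; exact: wdom_pull c fc. Qed.

Lemma piece_nonempty (o : piece) : exists t : space (pob o), True.
Proof. by have [[t _] _] := wdom_conn (piece_I o); exists t. Qed.

Definition pull_branch (x y : full (wdom I)) (f : @hom X (sval x) (sval y)) :
  wI I y -> wI I x := wfn (@cmap _ _ I x y f).

Lemma pull_branch1 (x : full (wdom I)) i : pull_branch (idm (sval x)) i = i :> wI I x.
Proof. by rewrite /pull_branch (@cmap1 _ _ I x). Qed.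

Lemma pull_branchM (x y z : full (wdom I)) (f : @hom X (sval y) (sval z))
    (g : @hom X (sval x) (sval y)) i :
  pull_branch (x := x) (y := z) (f \c g) i = pull_branch g (pull_branch f i).
Proof. by rewrite /pull_branch (@cmapM _ _ I x y z f g). Qed.

Lemma pull_branch_weq (x y : full (wdom I)) (f : @hom X (sval x) (sval y)) i j :
  weq (pull_branch f i) (pull_branch f j) -> weq i j.
Proof. exact: wfn_eq. Qed.

Lemma pull_branch_iso_weq (x y : full (wdom I)) (f : @hom X (sval x) (sval y)) i j :
  is_iso (@cmap _ _ I x y f) -> weq i j -> weq (pull_branch f i) (pull_branch f j).
Proof. exact: iso_weq. Qed.

Lemma resb_surj (o1 o2 : piece) (a : o1 ~> o2) (i : branches o1) : exists j, resb a j = i.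
Proof. exact: wmor_surj. Qed.

(* By [wI_local] a curve has an open, hence isomorphic, subfamily with the same
   branches as a curve mapping to it. *)
Lemma pull_branch_curve_weq (g g0 : full (wdom I)) (chi : @hom X (sval g0) (sval g)) i j :
  is_curve (sval g) -> is_curve (sval g0) -> weq i j ->
      weq (pull_branch chi i) (pull_branch chi j).
Proof.
move=> gc g0c ij.
have [U [u [psi [uo upsi psi_iso]]]] := @wI_local _ _ _ I g0 g chi g0c.
have [|r rE] := @open_sub_factor _ _ _ _ _ (u : @hom X _ _) (idm (sval g)) uo.
  move=> t; case: g0c => t0 _; case: gc => t1 t1P.
  by exists (smap (psi : @hom X _ _) t0) => //; exact: etrans (t1P _) (esym (t1P _)).
have ruE k : pull_branch (x := g) (y := U) r (pull_branch (u : @hom X _ _) k) = k.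
  by rewrite -pull_branchM rE pull_branch1.
have {}ij : weq (pull_branch (u : @hom X (sval U) (sval g)) i) (pull_branch (u :
    @hom X (sval U) (sval g)) j).
  by apply: (@pull_branch_weq _ _ r); rewrite !ruE.
have := pull_branch_iso_weq psi_iso ij; rewrite -!pull_branchM.
by move: upsi => /= ->.
Qed.

Definition inseparable (o : piece) (i j : branches o) : set (space (pob o)) :=
  [set p | forall (g : full (wdom I)) (c : @hom X (sval g) (pob o)),
     is_curve (sval g) -> range (smap c) p -> weq (branch_at c i) (branch_at c j)].

Lemma inseparable_sym (o : piece) (i j : branches o) p : inseparable i j p ->
    inseparable j i p.
Proof. by move=> h g c gc cp; apply: weq_sym; exact: h. Qed.

Lemma inseparable_trans (o : piece) (i j k : branches o) p : inseparable i j p ->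
    inseparable j k p -> inseparable i k p.
Proof. by move=> h h' g c gc cp; apply: (weq_trans (h _ _ gc cp)); exact: h'. Qed.

(** One curve at a point decides for all of them: the curve of [curve_at] maps to any two, and
    pullback between curves both preserves and reflects equivalence. *)
Lemma inseparable_curve (o : piece) (i j : branches o) (g : full (wdom I))
    (c : @hom X (sval g) (pob o)) t :
  is_curve (sval g) -> weq (branch_at c i) (branch_at c j) -> inseparable i j (smap c t).
Proof.
move=> gc ij g' c' gc' c'p.
have [f0 [c0 [f0c c0p c0k]]] := curve_at (smap c t).
pose g0 : full (wdom I) := exist _ f0 (wdom_curve c0 f0c (piece_I o)).
have [k kE] := c0k _ c (imageT _ t).
have [k' k'E] := c0k _ c' c'p.
apply: (@pull_branch_weq g0 g' k').
have := @pull_branch_curve_weq g g0 k _ _ gc f0c ij.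
by rewrite -!(@pull_branchM g0 _ (pdom o)) kE k'E.
Qed.

(** If [i] and [j] are separated at a curve [g], take an open [U] around it with [I(U)] isomorphic
    to [I(g)]. Equivalence at any point of [U] would reflect to [I(U)] and so hold at [g]. *)
Lemma inseparable_closed (o : piece) (i j : branches o) : closed (inseparable i j).
Proof.
rewrite -openC openE => p /existsNP[g /existsNP[c /not_implyP[gc /not_implyP[cp nij]]]].
have [U [u [psi [uo upsi psi_iso]]]] := @wI_local _ _ _ I g (pdom o) c gc.
case: cp => t _ tp.
have up : range (smap (u : @hom X _ _)) p.
  exists (smap (psi : @hom X _ _) t) => //; rewrite -smapM -tp.
  by move: upsi => /= ->.
apply: filterS (open_nbhs_nbhs (conj (open_sub_range uo) up)) => q uq Zq.
have [f' [c' [f'c c'q _]]] := curve_at q.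
pose g' : full (wdom I) := exist _ f' (wdom_curve c' f'c (piece_I o)).
have [|d dE] := @open_sub_factor _ _ _ _ _ (u : @hom X _ _) c' uo.
  by move=> s; rewrite c'q.
case: (f'c) => s _; have := Zq g' c' f'c.
have c'rq : range (smap c') q by exists s => //; exact: c'q.
move=> /(_ c'rq).
have cbE (k : branches o) :
    @branch_at _ _ _ _ g' o c' k = @pull_branch g' U d (@pull_branch U (pdom o) u k) by
        rewrite -pull_branchM dE.
rewrite !cbE => /pull_branch_weq /(pull_branch_iso_weq psi_iso) ij; apply: nij.
by move: ij; rewrite -!(@pull_branchM g U (pdom o)); move: upsi => /= ->.
Qed.

End Separation.

(** * Patching *)

Section LocalPatching.
Variables (R : realType) (X : stack R) (K : Kcategory X).
Variables (I : branched_cover K) (S : presheaf (Kcat K)).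

Local Notation "x ~> y" := (@hom X (sval (x : Kcat K)) (sval (y : Kcat K))) (at level 70).
Local Notation piece := (piece I).
Local Notation presec := (presec I S).

Hypothesis Ssheaf : is_sheaf S.

(** Every branch over [o] is the restriction of some branch [i] of [e]. Two choices of [i] are
    inseparable along the image of [f], so the corresponding sections have the same restriction. *)
Lemma presection_of_family (e : piece) (th : branches e -> S (pfam e)) :
  (forall i j p, inseparable i j p -> agree_near (th i) (th j) p) ->
  exists m : presec e, section_on setT m /\
    forall (o : piece) (f : o ~> e) i, m o f (resb f i) = restr f (th i).
Proof.
move=> thZ.
have wd (o : piece) (f : o ~> e) i j : resb f i = resb f j ->
    restr f (th i) = restr f (th j).
  move=> ij; apply: (sheaf_local Ssheaf) => p; apply: agree_near_pull; apply: thZ.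
  have [g0 [c [gc cp _]]] := curve_at p.
  pose g : full (wdom I) := exist _ g0 (wdom_curve c gc (piece_I o)).
  case: (gc) => t _; rewrite -(cp t) -smapM.
  apply: (@inseparable_curve _ _ _ _ e i j g (f \c c) t gc).
  by rewrite !(@branch_atM _ _ _ _ g o e) ij weq_refl.
pose m : presec e := fun o f i => restr f (th (sval (cid (resb_surj f i)))).
have mE (o : piece) (f : o ~> e) i : m o f (resb f i) = restr f (th i).
  by apply: wd; exact: (svalP (cid (resb_surj f (resb f i)))).
exists m; split=> //; split=> [ o1 o2 a f _ i'| o f _ i' j' g c gc ij t].
  have [i <-] := resb_surj f i'; rewrite mE -(@resbM _ _ _ _ o1 o2 e) mE.
  by rewrite -(@restrM _ _ _ _ o1 o2 e).
have [i iE] := resb_surj f i'; have [j jE] := resb_surj f j'; subst.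
rewrite !mE; apply: agree_near_pull; apply: thZ; rewrite -smapM.
by apply: (@inseparable_curve _ _ _ _ e i j g (f \c c) t gc);
    rewrite !(@branch_atM _ _ _ _ g o e).
Qed.

Hypothesis Spatch : Patching S.
Hypothesis Sinh : forall x : Kcat K, inhabited (S x).

Section Data.
Variables (e : piece) (A : Type) (V : A -> set (space (sval (pfam e)))) (m : A -> presec e).
Arguments m _ _ _ _ : clear implicits.
Hypothesis Vo : forall a, open (V a).
Hypothesis Vc : forall p, exists a, V a p.
Hypothesis ms : forall a, section_on (V a) (m a).

(** The component at [i] of the condition [good] on a section over [e]. *)
Definition tracks (i : branches e) (s : S (pfam e)) : Prop :=
  forall (z : Kcat K) (phi : z ~> e) (n : wsec I S z),
    compat (y := pfam e) V m phi n ->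
    forall (o : piece) (f : o ~> z),
      restr (phi \c f) s = vals n f (@resb _ _ _ _ o e (phi \c f) i).

Definition data_agree (i j : branches e) : set (space (sval (pfam e))) :=
  [set p | exists a (o : piece) (u : o ~> e), [/\ open_sub u, range (smap u) p,
     over (V a) u & m a o u (resb u i) = m a o u (resb u j)]].

Lemma data_agree_open i j : open (data_agree i j).
Proof.
rewrite openE => p [a [ o [u [uo up uV um]]]].
apply: filterS (open_nbhs_nbhs (conj (open_sub_range uo) up)) => q uq.
by exists a, o, u.
Qed.

(** Some datum [m a] is defined near [p]; its separation condition at a curve through [p] identifies
    its values at [i] and [j] there. *)
Lemma inseparable_sub_data_agree i j : inseparable i j `<=` data_agree i j.
Proof.
move=> p Zp; have [a ap] := Vc p.
have [ o [u [uo up uV]]] := @small_piece _ _ _ I (pfam e) _ p (Vo a) ap.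
have [g0 [c [gc cp _]]] := curve_at p.
have [|d dE] := @open_sub_factor _ _ _ _ _ u c uo.
  by move=> t; rewrite cp.
pose g : full (wdom I) := exist _ g0 (wdom_curve c gc (piece_I e)).
case: (gc) => t _.
have cr : range (smap c) p by exists t; rewrite ?cp.
have ij : weq (@branch_at _ _ _ _ g o d (resb u i)) (@branch_at _ _ _ _ g o d (resb u j)).
  by rewrite -!(@branch_atM _ _ _ _ g o e) dE; exact: Zp.
have [U [v [vo [q _ qd] vm]]] := (ms a).2 o u uV _ _ g d gc ij t.
have [ w [u' [u'o [r _ rq] _]]] := @small_piece _ _ _ I U setT q openT Logic.I.
exists a, w, (u \c (v \c u')); split.
- by do 2!apply: open_sub_comp => //.
- by exists r => //; rewrite !smapM rq qd -smapM dE cp.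
- exact: over_comp.
- rewrite !(@resbM _ _ _ _ w o e) -!((ms a).1 w o) // !(@restrM _ _ _ _ w U o).
  by rewrite vm.
Qed.

Hypothesis e_normal : forall C O : set (space (sval (pfam e))),
  closed C -> open O -> C `<=` O ->
  exists B, [/\ open B, C `<=` B & closure B `<=` O].

Lemma family_step (L : seq (branches e)) (th : branches e -> S (pfam e)) (i : branches e) :
  {in L &, forall j j', inseparable j j' `<=` agree_near (th j) (th j')} ->
  {in L, forall j, tracks j (th j)} ->
  exists s, tracks i s /\ {in L, forall j, inseparable i j `<=` agree_near s (th j)}.
Proof.
move=> thZ thT.
(* The new section must equal th j near the locus where i and j are
   inseparable, for all j in L at once. The sets O j are chosen so that the
   prescribed values th j, th j' agree where this matters, and that compatible
   sections do not distinguish i and j over O j. *)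
pose O j := data_agree i j `&` [set p | forall j', j' \in L -> inseparable i j' p ->
    agree_near (th j) (th j') p].
have Oo j : open (O j).
  apply: openI; first exact: data_agree_open.
  rewrite openE => p hp.
  suff : \forall q \near p, forall j', j' \in L -> inseparable i j' q ->
      agree_near (th j) (th j') q by [].
  (* There are finitely many [j'] to consider. For each in [L], either [th j] and [th j'] agree near
     [p], or [p] has a neighbourhood off the closed locus where [i] and [j'] are inseparable. *)
  apply: filter_forall => j'.
  have [j'L|_] := boolP (j' \in L); last by apply: filterS filterT.
  have [Zp|nZp] := pselect (inseparable i j' p).
    have := open_nbhs_nbhs (conj (@agree_near_open _ _ _ _ (pfam e) (th j) (th j')) (hp
        _ j'L Zp)).
    by apply: filterS.
  have := open_nbhs_nbhs (conj (closed_openC (@inseparable_closed _ _ _ _ e i j')) nZp).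
  by apply: filterS.
have ZO j : j \in L -> inseparable i j `<=` O j.
  move=> jL p Zp; split; first exact: inseparable_sub_data_agree.
  move=> j' j'L Zp'; apply: thZ => //.
  by apply: inseparable_trans Zp'; exact: inseparable_sym.
(* Two shrinkings, [B' j] inside [B j] inside [O j]: [th j] is prescribed on [B j], and the given
   data are used only off the closures of all [B' j]. The two kinds of pieces, [C1] and [C2], then
   cover [e], and only [C1] occurs within [B' j]. *)
have B2 (j : branches e) : exists BB :
    set (space (sval (pfam e))) * set (space (sval (pfam e))), j \in L ->
    [/\ open BB.1 /\ open BB.2, inseparable i j `<=` BB.2, closure BB.2 `<=` BB.1 &
        closure BB.1 `<=` O j].
  have [jL|_] := boolP (j \in L); last by exists (setT, setT).
  have [B1 [B1o ZB1 B1O]] := e_normal (@inseparable_closed _ _ _ _ e i j) (Oo j) (ZO j jL).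
  have [B2 [B2o ZB2 B2B1]] := e_normal (@inseparable_closed _ _ _ _ e i j) B1o ZB1.
  by exists (B1, B2).
pose B j := (sval (cid (B2 j))).1; pose B' j := (sval (cid (B2 j))).2.
have BP j : j \in L -> [/\ open (B j) /\ open (B' j), inseparable i j `<=` B' j,
    closure (B' j) `<=` B j & closure (B j) `<=` O j] by exact: (svalP (cid (B2 j))).
pose C1 (w : piece) (u : w ~> e) (t : S (pfam w)) :=
  exists j, [/\ j \in L, over (B j) u & t = restr u (th j)].
pose C2 (w : piece) (u : w ~> e) (t : S (pfam w)) :=
  exists a, [/\ over (V a) u, forall j, j \in L -> over (~` closure (B' j)) u &
    t = m a w u (resb u i)].
pose Idx := {w : piece & {ut : (w ~> e) * S (pfam w) | open_sub ut.1 /\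
  (C1 w ut.1 ut.2 \/ C2 w ut.1 ut.2)}}.
pose ux (a : Idx) : @hom (Kcat K) (pfam (projT1 a)) (pfam e) := (sval (projT2 a)).1.
have [|s sP] := @Spatch Idx (pfam e) (fun a => pfam (projT1 a)) ux
    (fun a => (sval (projT2 a)).2).
  split=> [a|p]; first by have [] := svalP (projT2 a).
  have [[j [jL jp]]|nB] := pselect (exists j, j \in L /\ B j p).
    have [[Bo _] _ _ _] := BP j jL.
    have [ w [u [uo up uB]]] := @small_piece _ _ _ I (pfam e) _ p Bo jp.
    have ut : C1 w u (restr u (th j)) by exists j.
    by exists (existT _ w (exist _ (u, restr u (th j)) (conj uo (or_introl ut)))).
  have [a ap] := Vc p.
  pose N := V a `&` [set q | forall j, j \in L -> ~ closure (B' j) q].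
  have No : open N.
    apply: openI => //; rewrite openE => q hq.
    suff : \forall q' \near q, forall j, j \in L -> ~ closure (B' j) q' by [].
    apply: filter_forall => j.
    have [jL|_] := boolP (j \in L); last by apply: filterS filterT.
    have := open_nbhs_nbhs (conj (closed_openC (@closed_closure _ (B' j))) (hq _ jL)).
    by apply: filterS.
  have Np : N p.
    split=> // j jL jp; apply: nB; exists j; split=> //.
    by have [_ _ + _] := BP j jL; apply.
  have [ w [u [uo up uN]]] := @small_piece _ _ _ I (pfam e) _ p No Np.
  have ut : C2 w u (m a w u (resb u i)).
    by exists a; split=> // [t|j jL t]; have [] := uN t => // _; apply.
  by exists (existT _ w (exist _ (u, m a w u (resb u i)) (conj uo (or_intror ut)))).
(* The hypothesis is asked for all commutative squares, which include the pullback squares of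
   [Patching]. *)
have {}sP (z : Kcat K) (phi : z ~> e) (s' : S z) :
    (forall (w : piece) (u : w ~> e) t, C1 w u t \/ C2 w u t ->
      forall (x : Kcat K) (p1 : x ~> z) (p2 : x ~> w), phi \c p1 = u \c p2 ->
      restr p1 s' = restr p2 t) -> restr phi s = s'.
  move=> H; apply: sP => -[ w [[u t] /= [uo ut]]] x p1 p2 [pE _].
  exact: (H w u t ut x p1 p2 pE).
exists s; split=> [z phi n nc o f|j jL p Zp].
- apply: sP => w u t ut x p1 p2 pE; case: ut.
  (* Here [th j] restricts to the [j]-th branch of [n]. As [B j] lies in [data_agree i j], the data,
     and with them the compatible section [n], take the same values locally at the restrictions of
     [i] and [j]. *)
  + case=> j [jL uB ->]; rewrite -restrM -pE.
    rewrite (@restrM _ _ _ _ x o (pfam e)) (thT j jL z phi n nc).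
    have [_ _ _ BO] := BP j jL.
    apply: (sheaf_local_pieces (I := I) Ssheaf) => q.
    have Gq : data_agree i j (smap ((phi \c f) \c p1) q).
      by rewrite pE smapM; have [] := BO _ (subset_closure (uB (smap p2 q))).
    have [a [w' [v [vo vq vV vm]]]] := Gq.
    have [Y [q1 [q2 [q1o q12 q1r]]]] := open_pullback ((phi \c f) \c p1) vo.
    pose YK : Kcat K := exist _ Y (inK_open q1o (svalP x)).
    have [q' _ qq'] : range (smap q1) q by rewrite q1r.
    have [w'' [v' [v'o [r _ rq] _]]] := @small_piece _ _ _ I YK setT q' openT Logic.I.
    exists w'', (q1 \c v'); split.
    * exact: open_sub_comp.
    * by exists r => //; rewrite smapM rq.
    pose h : w'' ~> o := p1 \c (q1 \c v').
    have hE : phi \c (f \c h) = v \c (q2 \c v') by rewrite !compA -q12 -!compA.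
    have hV : over (V a) (phi \c (f \c h)) by rewrite hE; exact: over_comp.
    rewrite -!(@restrM _ _ _ _ w'' x o) -/h.
    rewrite !(section_on_vals setT n).1 // !(nc a w'' (f \c h) hV).
    rewrite -!(@resbM _ _ _ _ w'' o e) -compA hE.
    rewrite !(@resbM _ _ _ _ w'' w' e) -!((ms a).1 w'' w') //.
    by rewrite vm.
  + case=> a [uV _ ->].
    apply: (sheaf_local_pieces (I := I) Ssheaf) => q.
    have [ w' [v [vo vq _]]] := @small_piece _ _ _ I x setT q openT Logic.I.
    exists w', v; split=> //.
    have hE : phi \c (f \c (p1 \c v)) = u \c (p2 \c v) by rewrite !compA pE.
    have hV : over (V a) (phi \c (f \c (p1 \c v))) by rewrite hE; exact: over_comp.
    rewrite -(@restrM _ _ _ _ w' x o) -(@restrM _ _ _ _ w' x w).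
    rewrite (section_on_vals setT n).1 // (nc a w' _ hV) -(@resbM _ _ _ _ w' o e) -compA hE.
    by rewrite (@resbM _ _ _ _ w' w e) -((ms a).1 w' w).
(* Inside [B' j] no piece of kind [C2] occurs. If the closure of [B j'] contains [p], then [p] lies
   in [O j'] and in the locus where [i] and [j] are inseparable, so [th j'] equals [th j] near [p];
   the other [B j'] are avoided by shrinking. *)
- pose N := B' j `&` [set q | forall j', j' \in L -> closure (B j') q ->
    agree_near (th j) (th j') q].
  have [[_ B'o] ZB' _ _] := BP j jL.
  have Np : nbhs p N.
    apply: filterI; first exact: (open_nbhs_nbhs (conj B'o (ZB' _ Zp))).
    suff : \forall q \near p, forall j', j' \in L -> closure (B j') q ->
        agree_near (th j) (th j') q by [].
    apply: filter_forall => j'.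
    have [j'L|_] := boolP (j' \in L); last by apply: filterS filterT.
    have [Bp|nBp] := pselect (closure (B j') p).
      have [_ _ _ BO] := BP j' j'L; have [_ /(_ j jL Zp) /agree_near_sym Ep] := BO _ Bp.
      have := open_nbhs_nbhs (conj (@agree_near_open _ _ _ _ (pfam e) (th j) (th j')) Ep).
      by apply: filterS.
    have := open_nbhs_nbhs (conj (closed_openC (@closed_closure _ (B j'))) nBp).
    by apply: filterS.
  have [ o [u [uo up uN]]] := @small_piece _ _ _ I (pfam e) _ p (@open_interior _ N) Np.
  exists (pfam o), u; split=> //; apply: sP => w u' t ut x p1 p2 pE.
  have xN q : N (smap u' (smap p2 q)).
    rewrite -smapM -pE smapM; exact: interior_subset (uN _).
  case: ut => [[j' [j'L uB ->]]|[a [_ uB' _]]]; apply: (sheaf_local Ssheaf) => q.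
    rewrite -(@restrM _ _ _ _ x w) -(@restrM _ _ _ _ x o) pE; apply: agree_near_pull.
    rewrite smapM; have [_] := xN q; apply => //.
    exact/subset_closure/uB.
  by have [/subset_closure B'q _] := xN q; case: (uB' j jL (smap p2 q)).
Qed.

(** Induction on the list: [family_step] adds one component and leaves the earlier ones
    unchanged. *)
Lemma families_exist (L : seq (branches e)) : exists th : branches e -> S (pfam e),
  {in L &, forall j j', inseparable j j' `<=` agree_near (th j) (th j')} /\
  {in L, forall j, tracks j (th j)}.
Proof.
elim: L => [|i L [th [thZ thT]]].
  by have [s] := Sinh (pfam e); exists (fun=> s).
have [iL|iL] := boolP (i \in L).
  exists th; split=> [j j'|j]; rewrite !inE.
    by move=> /predU1P[->|jL] /predU1P[->|j'L]; exact: thZ.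
  by move=> /predU1P[->|jL]; exact: thT.
have [s [sT sZ]] := family_step i thZ thT.
exists (fun j => if j == i then s else th j); split=> [j j'|j]; rewrite !inE.
  case: eqP => [-> _|_ /= jL]; case: eqP => [-> _|_ /= j'L] p.
  - by move=> _; exact: agree_near_refl.
  - exact: sZ.
  - by move=> /inseparable_sym h; apply: agree_near_sym; exact: sZ.
  - exact: thZ.
by case: eqP => [-> _|_ /= jL]; [|exact: thT].
Qed.

Theorem local_patching : exists mu : presec e,
  section_on (y := pfam e) setT mu /\ good (y := pfam e) V m setT mu.
Proof.
have [th [thZ thT]] := families_exist (enum (branches e)).
have [|mu [mus muE]] := @presection_of_family e th.
  by move=> i j; apply: thZ; rewrite mem_enum.
exists mu; split=> // z phi n nc o f _ i'.
have [i <-] := @resb_surj _ _ _ _ o e (phi \c f) i'.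
by rewrite muE -(thT i _ z phi n nc) // mem_enum.
Qed.

End Data.
End LocalPatching.

(** * Patching over an arbitrary family by exhaustion *)

Section GlobalPatching.
Variables (R : realType) (X : stack R) (K : Kcategory X).
Variables (I : branched_cover K) (S : presheaf (Kcat K)).

Local Notation "x ~> y" := (@hom X (sval (x : Kcat K)) (sval (y : Kcat K))) (at level 70).
Local Notation piece := (piece I).
Local Notation presec := (presec I S).

Hypothesis Ssheaf : is_sheaf S.
Hypothesis Spatch : Patching S.
Hypothesis Sinh : forall x : Kcat K, inhabited (S x).

Lemma space_normal (x : X) (C O : set (space x)) : closed C -> open O -> C `<=` O ->
  exists B, [/\ open B, C `<=` B & closure B `<=` O].
Proof. by have [sc reg _] := svalP (stF X x); exact: normal_shrink. Qed.

Lemma space_basis (x : X) : exists b : nat -> set (space x),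
  (forall n, open (b n)) /\
  forall (p : space x) U, nbhs p U -> exists n, b n p /\ closure (b n) `<=` U.
Proof.
have [sc reg _] := svalP (stF X x); have [b [bo bP]] := second_countable_seq sc.
by exists b; split=> //; exact: regular_basis.
Qed.

Lemma over_nonempty (y : X) (o : piece) (W : set (space y)) (f : hom (pob o) y) :
  over W f -> exists p, W p.
Proof. by move=> fW; have [t _] := piece_nonempty o; exists (smap f t). Qed.

(** The factorization [k] of a map through [u] is unique, so [mu] is well defined; on maps that do
    not factor its value is arbitrary. *)
Lemma section_on_range (y x : Kcat K) (u : x ~> y) (th : presec x) :
  open_sub u -> section_on setT th ->
  exists mu : presec y, section_on (range (smap u)) mu /\
    forall (w : piece) (k : w ~> x) i, mu w (u \c k) i = th w k i.
Proof.
move=> uo [thn ths].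
have ex (w : piece) (f : w ~> y) i : exists s : S (pfam w),
    forall k : w ~> x, u \c k = f -> s = th w k i.
  have [[k kE]|nk] := pselect (exists k : w ~> x, u \c k = f).
    by exists (th w k i) => k' k'E; congr (th w _ i); apply: (open_sub_mono uo); rewrite kE.
  by have [s] := Sinh (pfam w); exists s => k kE; case: nk; exists k.
pose mu : presec y := fun w f i => sval (cid (ex w f i)).
have muE (w : piece) (k : w ~> x) i : mu w (u \c k) i = th w k i.
  exact: (svalP (cid (ex w (u \c k) i))).
exists mu; split=> //; split=> [ o1 o2 a f fu i| w f fu].
  have [k kE] := @open_sub_factor _ _ _ _ _ u f uo fu.
  by rewrite -kE muE -compA muE thn.
have [k <-] := @open_sub_factor _ _ _ _ _ u f uo fu.
by move=> i j g c gc ij t; rewrite !muE; exact: ths.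
Qed.

Variables (y : Kcat K) (A : Type) (V : A -> set (space (sval y))) (m : A -> presec y).
Arguments m _ _ _ _ : clear implicits.
Hypothesis Vo : forall a, open (V a).
Hypothesis Vc : forall p, exists a, V a p.
Hypothesis ms : forall a, section_on (V a) (m a).

(** Over [o], the solution [mu0] joins the data under the index [None], and the given data are
    restricted to the complement of a closed neighbourhood of [C]. This forces the new solution to
    equal [mu0] near [C]. *)
Lemma extend_section (C : set (space (sval y))) V0 (mu0 : presec y) (o : piece) (u : o ~> y)
    (D : set (space (sval y))) :
  closed C -> open V0 -> C `<=` V0 -> section_on V0 mu0 -> good V m V0 mu0 ->
  open_sub u -> D `<=` range (smap u) ->
  exists V1 (mu1 : presec y), [/\ open V1, section_on V1 mu1, good V m V1 mu1,
    C `|` D `<=` V1 & forall (w : piece) (f : w ~> y), over C f ->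
      forall i, mu0 w f i = mu1 w f i].
Proof.
move=> cC oV0 CV0 s0 g0 uo Du.
have [V' [oV' CV' V'V0]] := space_normal cC oV0 CV0.
have V'V0' := subset_trans (@subset_closure _ V') V'V0.
pose VV (a : option A) : set (space (sval (pfam o))) :=
  if a is Some a then smap u @^-1` (V a `&` ~` closure V') else smap u @^-1` V0.
pose mm (a : option A) : presec o := if a is Some a then pull u (m a) else pull u mu0.
have [||||th [ths thg]] := @local_patching _ _ _ _ _ Ssheaf Spatch Sinh o (option A) VV mm.
- case=> [a|]; apply: open_preimage => //; apply: openI => //.
  exact/closed_openC/closed_closure.
- move=> p; have [pV|npV] := pselect (closure V' (smap u p)).
    by exists None; exact: V'V0.
  by have [a ap] := Vc (smap u p); exists (Some a).
- case=> [a|]; apply: section_on_pull => //.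
  by apply: section_on_sub (ms a) => p [].
- move=> C' O'; exact: space_normal.
(* Over [V'] the pullback of [mu0] is itself compatible with the modified data, since no piece,
   being nonempty, lies both over [V'] and off its closure. Goodness of [th] then gives the
   equality. *)
have thmu0 (w : piece) (k : w ~> o) : over V' (u \c k) ->
    forall i, th w k i = mu0 w (u \c k) i.
  move=> kV' i.
  have sk : section_on (y := pfam w) setT (pull (x := pfam w) (u \c k) mu0).
    apply: section_on_sub (section_on_pull (x := pfam w) (u \c k) s0) => p _.
    exact/V'V0'/kV'.
  have [n nE] := to_wsec sk.
  have := thg (pfam w) k n _ w (idm (pob w)) (fun _ => Logic.I) i.
  rewrite nE /pull !compm1 => -> // -[a|] o' f fV j; rewrite nE.
    have [t _] := piece_nonempty o'.
    have [_ /=] := fV t; rewrite smapM; case.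
    rewrite -smapM; exact/subset_closure/kV'.
  by rewrite /= /pull compA.
have [nu [nus nuE]] := section_on_range (x := pfam o) uo ths.
(* A section compatible with the given data agrees with [mu0] over [V0], as [mu0] is good; hence it
   is compatible with the modified data. *)
have nug : good V m (range (smap u)) nu.
  move=> z phi n nc w f fu i.
  have [k kE] := @open_sub_factor _ _ _ _ _ u (phi \c f) uo fu.
  rewrite -kE nuE.
  have := thg (pfam w) k (@wsec_res _ _ _ _ _ (pfam w) z f n) _ w (idm (pob w)) (fun _
      => Logic.I) i.
  rewrite compm1 => <-; first by rewrite /vals /= /sl_push /= compm1.
  have fE o' (g : o' ~> w) : u \c (k \c g) = phi \c (f \c g).
    by rewrite !compA kE.
  move=> [a|] o' g gV j.
    rewrite -[LHS]/(vals n (f \c g) j) /= /pull fE; apply: nc.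
    by rewrite -fE; apply/over_preimage => t; have [] := gV t.
  rewrite -[LHS]/(vals n (f \c g) j) /= /pull fE; apply: (g0) => //.
  by rewrite -fE; apply/over_preimage.
pose W (b : bool) := if b then V' else range (smap u).
pose mu (b : bool) := if b then mu0 else nu.
have Wo b : open (W b) by case: b => //; exact: open_sub_range.
have Ws b : section_on (W b) (mu b) by case: b => //; exact: section_on_sub s0.
have agree (w : piece) (f : w ~> y) : over V' f -> over (range (smap u)) f ->
    forall i, mu0 w f i = nu w f i.
  move=> fV' fu i; have [k kE] := @open_sub_factor _ _ _ _ _ u f uo fu.
  by rewrite -kE nuE thmu0 // kE.
have [|mu1 [mu1s mu1E]] := glue_presections Ssheaf Sinh Wo Ws.
  case=> -[] // w f fW fW' i.
  exact: (esym (agree w f fW' fW i)).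
exists [set p | exists b, W b p], mu1; split=> //.
- rewrite (_ : [set p | _] = \bigcup_b W b); first exact: bigcup_open.
  by apply/seteqP; split=> p [b]; [exists b | exists b].
- apply: good_union => // b z phi n nc w f fW i; rewrite (mu1E b) //.
  case: b fW => fW; last exact: nug.
  by apply: (g0 z phi n nc) => t; exact/V'V0'/fW.
- by move=> p [/CV' pV'|/Du pu]; [exists true|exists false].
- by move=> w f fC i; rewrite (mu1E true) // => t; exact: CV'.
Qed.

Theorem global_patching : exists mu : presec y, section_on setT mu /\ good V m setT mu.
Proof.
have [b [bo bP]] := space_basis (sval y).
(* [bb n] is [b n] if the closure of [b n] lies in the range of a piece, and empty otherwise, so the
   exhaustion is fixed before any section is built. *)
pose g n := exists (o : piece) (u :
    o ~> y), open_sub u /\ closure (b n) `<=` range (smap u).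
pose bb n := [set p | g n /\ b n p].
pose C n := \bigcup_(k < n) closure (bb k).
pose P n (s : set (space (sval y)) * presec y) :=
  [/\ open s.1, section_on s.1 s.2, good V m s.1 s.2 & C n `<=` s.1].
pose agree n (s s' : set (space (sval y)) * presec y) :=
  forall (w : piece) (f : w ~> y), over (C n) f -> forall i, s.2 w f i = s'.2 w f i.
have CS n : C n.+1 = C n `|` closure (bb n).
  by rewrite /C !bigcup_mkord big_ord_recr.
have Ccl n : closed (C n).
  apply: closed_bigcup => [|k _]; [exact: finite_II|exact: closed_closure].
have step n s : P n s -> exists s', P n.+1 s' /\ agree n s s'.
  case: s => V0 mu0 [/= oV0 s0 g0 CV0].
  have [[ o [u [uo bu]]]|ng] := pselect (g n).
    have bbu : closure (bb n) `<=` range (smap u).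
      by apply: subset_trans bu; apply: closureS => p [].
    have [V1 [mu1 [oV1 s1 g1 CV1 a1]]] := extend_section (Ccl n) oV0 CV0 s0 g0 uo bbu.
    by exists (V1, mu1); split=> //; split=> //=; rewrite CS.
  exists (V0, mu0); split=> //; split=> //=; rewrite CS => p [/CV0 //|].
  rewrite (_ : bb n = set0) ?closure0 //.
  by apply/seteqP; split=> q // [].
(* The start is the empty set with arbitrary values; the conditions hold vacuously because pieces
   are nonempty. *)
have [s0 P0] : exists s, P 0%N s.
  exists (set0, fun o f i => sval (cid (let: inhabits s := Sinh (pfam o) in
    ex_intro (fun=> True) s Logic.I))).
  split=> /=; first exact: open0.
  - split=> [ o1 o2 a f /over_nonempty[p []]|].
    by move=> o f /over_nonempty[p []].
  - by move=> z phi n _ o f /over_nonempty[p []].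
  - by move=> p [].
pose next n (s : {s | P n s}) : {s | P n.+1 s} :=
  exist _ (sval (cid (step n _ (svalP s)))) (svalP (cid (step n _ (svalP s)))).1.
pose fix st n : {s | P n s} := if n is n'.+1 then next _ (st n') else exist _ s0 P0.
pose mu n := (sval (st n)).2.
have muS n : agree n (sval (st n)) (sval (st n.+1)).
  exact: (svalP (cid (step n _ (svalP (st n))))).2.
(* Later solutions agree with the [n]-th one over [C n], hence over its open subset [W n], so the
   restrictions to the [W n] glue. *)
pose W n := \bigcup_(k < n) bb k.
have WC n : W n `<=` C n by move=> p [k kn bp]; exists k => //; exact: subset_closure.
have Wo n : open (W n).
  apply: bigcup_open => k _; have [gk|ng] := pselect (g k).
    by rewrite (_ : bb k = b k) //; apply/seteqP; split=> p // [].
  by rewrite (_ : bb k = set0); [exact: open0|apply/seteqP; split=> q // []].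
have WV n : W n `<=` (sval (st n)).1.
  by have [_ _ _ CV] := svalP (st n); exact: subset_trans CV.
have Ws n : section_on (W n) (mu n).
  by have [_ ss _ _] := svalP (st n); exact: section_on_sub ss.
have le_mu n n' : (n <= n')%N -> forall (w : piece) (f : w ~> y), over (W n) f ->
    forall i, mu n w f i = mu n' w f i.
  move=> nn' w f fW i; elim: n' nn' => [|n' IH]; first by rewrite leqn0 => /eqP ->.
  rewrite leq_eqVlt => /predU1P[-> //|]; rewrite ltnS => nn'.
  rewrite IH //; apply: muS => t; apply: WC.
  by have [k kn bk] := fW t; exists k => //=; exact: leq_trans nn'.
have [|mu1 [mu1s mu1E]] := glue_presections Ssheaf Sinh Wo Ws.
  move=> n n' w f fW fW' i; have [nn'|/ltnW nn'] := leqP n n'; first exact: le_mu.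
  by apply/esym; exact: le_mu.
have WT : [set p | exists n, W n p] = setT.
  apply/seteqP; split=> // p _.
  have [ o [u [uo up _]]] := small_piece I openT (Logic.I : setT p).
  have [n [bp bu]] := bP p _ (open_nbhs_nbhs (conj (open_sub_range uo) up)).
  exists n.+1, n => //=; split=> //; by exists o, u.
exists mu1; rewrite -WT; split=> //; apply: good_union => // n z phi nn nc w f fW i.
rewrite (mu1E n) //; have [_ _ gn _] := svalP (st n).
by apply: gn => // t; exact: WV.
Qed.

End GlobalPatching.

(** * The two axioms for weighted branched sections *)

Section WeightedAxioms.
Variables (R : realType) (X : stack R) (K : Kcategory X).
Variables (I : branched_cover K) (S : presheaf (Kcat K)).

Local Notation "x ~> y" := (@hom X (sval (x : Kcat K)) (sval (y : Kcat K))) (at level 70).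
Local Notation piece := (piece I).
Local Notation presec := (presec I S).

Hypothesis Ssheaf : is_sheaf S.
Hypothesis Spatch : Patching S.
Hypothesis Sext : Extension S.

Let Sinh : forall x : Kcat K, inhabited (S x) := proj1 Sext.

(** A piece over the range of [u a] factors through the fibre product with [x a], so the hypothesis
    of [Patching] on pullbacks yields [compat]. *)
Lemma weighted_patching : Patching (weighted_sections I S).
Proof.
move=> A y x u t [uo uc].
have ex a : exists mu : presec y, section_on (range (smap (u a : @hom X _ _))) mu /\
    forall (w : piece) (k : w ~> x a) i, mu w ((u a : @hom X _ _) \c k) i = vals (t a) k i.
  exact: (section_on_range Sinh (uo a) (section_on_vals setT (t a))).
pose m a : presec y := sval (cid (ex a)).
have ms a : section_on (range (smap (u a : @hom X _ _))) (m a).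
  by have [] := svalP (cid (ex a)).
have mE a (w : piece) (k : w ~> x a) i : m a w ((u a : @hom X _ _) \c k) i = vals (t a) k i.
  by have [_] := svalP (cid (ex a)); apply.
have [mu [mus mug]] := global_patching Ssheaf Spatch Sinh
  (fun a => open_sub_range (uo a)) uc ms.
have [s sE] := to_wsec mus; exists s => z phi s' s'P.
apply: wsec_ext => o f i; rewrite -[LHS]/(vals s ((phi : @hom X _ _) \c f) i) sE.
apply/esym; apply: (mug z phi s') => // a o' f' fV j.
have [w [p1 [p2 [pb p1o p1r]]]] := open_pullbackK phi (uo a).
have [|k kE] := @open_sub_factor _ _ _ _ _ (p1 : @hom X _ _) f' p1o.
  by move=> q; rewrite p1r /=; have := fV q; rewrite smapM.
have p12 : (phi : @hom X _ _) \c (p1 : @hom X _ _) = (u a : @hom X _ _) \c (p2 :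
    @hom X _ _).
  exact: (proj1 pb).
rewrite -kE compA p12 -compA mE.
have := congr1 (fun n => vals n k j) (s'P a w p1 p2 pb); exact.
Qed.

Lemma weighted_inhabited (y : Kcat K) : inhabited (wsec I S y).
Proof.
have [s] := Sinh y.
have [|n _] := @to_wsec _ _ _ I S y (fun o f i => restr f s); last by exists.
split=> [ o1 o2 a f _ i| o f _ i j g c _ _ t]; last exact: agree_near_refl.
by rewrite -(@restrM _ _ _ _ o1 o2 y).
Qed.

Lemma weighted_extension : Extension (weighted_sections I S).
Proof.
split; first exact: weighted_inhabited.
move=> z y phi t f c fc; case: (fc) => t0 t0P.
pose phi' : z ~> y := phi.
have [ o [v0 [v0o v0p _]]] := small_piece I openT (Logic.I : setT (smap phi' (smap c t0))).
have [|c1 c1E] := @open_sub_factor _ _ _ _ _ v0 (phi' \c c) v0o.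
  by move=> t1; rewrite smapM (t0P t1).
pose g : full (wdom I) := exist _ f (wdom_curve c1 fc (piece_I o)).
(* The family is shrunk until its branches are those of the curve, so that branches equivalent over
   [e] stay equivalent there. *)
have [[U UI] [u [psi [uo upsi psi_iso]]]] := @wI_local _ _ _ I g (pdom o) c1 fc.
have UK : inK K U by apply: (inK_open uo); exact: (@piece_K _ _ _ _ o).
pose e : piece := Piece UI UK.
pose v : e ~> y := v0 \c (u : @hom X _ _).
have vo : open_sub v by exact: open_sub_comp.
have vpsi : v \c (psi : @hom X _ _) = phi' \c c.
  by rewrite -c1E -compA; congr (_ \c _).
have vq : range (smap v) (smap phi' (smap c t0)).
  by exists (smap (psi : @hom X _ _) t0) => //; rewrite -!smapM vpsi.
have [n [n0 [n0o n0p n0v]]] :=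
  @small_piece _ _ _ I z _ (smap c t0) (open_preimage phi' (open_sub_range vo)) vq.
have [|d0 d0E] := @open_sub_factor _ _ _ _ _ n0 c n0o.
  by move=> t1; rewrite (t0P t1).
have [|k kE] := @open_sub_factor _ _ _ _ _ v (phi' \c n0) vo.
  by move=> t1; rewrite smapM; exact: n0v.
have kd0 : k \c d0 = psi :> @hom X _ _.
  by apply: (open_sub_mono vo); rewrite compA kE -compA d0E vpsi.
pose pt := smap d0 t0.
(* Equivalent branches of [e] are not separated at the curve, so the values of [t] have the same
   germ there. *)
have tE i j : weq i j ->
    agree_near (vals t n0 (resb (o2 := e) k i)) (vals t n0 (resb (o2 := e) k j)) pt.
  move=> ij; apply: ((section_on_vals setT t).2 n n0 _ _ _ g d0) => //.
  rewrite -!(@branch_atM _ _ _ _ g n e) kd0.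
  exact: (@pull_branch_iso_weq _ _ _ _ g (pdom e) psi i j psi_iso ij).
have ex (r : branches e) : exists th : S (pfam e), agree_near (restr (x :=
    pfam n) k th) (vals t n0 (resb k r)) pt.
  have [th [W [w [d [wo wd wE]]]]] :=
    (proj2 Sext) (pfam n) (pfam e) k (vals t n0 (resb (o2 := e) k r)) f d0 fc.
  by exists th; exact: (agree_near_of_curve (x := pfam n) t0 wo wd wE).
(* One extension is chosen per equivalence class. Branches inseparable at some point are equivalent,
   because restriction reflects equivalence, so their components are equal. *)
pose rep (i : branches e) := odflt i [pick j | weq i j].
have rep_weq i : weq (rep i) i.
  rewrite /rep; case: pickP => [j /weq_sym //|_]; exact: weq_refl.
have rep_eq i j : weq i j -> rep i = rep j.
  move=> ij; rewrite /rep (@eq_pick _ _ (weq j)); last first.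
    by move=> l; apply/idP/idP; apply: weq_trans => //; exact: weq_sym.
  by case: pickP => // /(_ j); rewrite weq_refl.
pose th i := sval (cid (ex (rep i))).
have thE i : agree_near (restr (x := pfam n) k (th i)) (vals t n0 (resb k i)) pt.
  by apply: agree_near_trans (svalP (cid (ex (rep i)))) _; exact/tE/rep_weq.
have [|m [ms mE]] := @presection_of_family _ _ _ _ _ Ssheaf e th.
  move=> i j p Zp; rewrite /th (rep_eq i j); first exact: agree_near_refl.
  have [h0 [h [h0c hp _]]] := curve_at p.
  pose h' : full (wdom I) := exist _ h0 (wdom_curve h h0c (piece_I e)).
  apply: (@pull_branch_weq _ _ _ _ h' (pdom e) h); apply: Zp => //.
  by case: (h0c) => t1 _; exists t1.
have [sigma sigmaE] := to_wsec (y := pfam e) ms.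
have [b [bo bP]] := space_basis (sval y).
have [l [bl blv]] := bP _ _ (open_nbhs_nbhs (conj (open_sub_range vo) vq)).
(* Near the curve all extended components agree with [t], and the image in [y] stays in [b l]. *)
pose N1 := [set q | forall i, agree_near (restr (x :=
    pfam n) k (th i)) (vals t n0 (resb k i)) q] `&`
  smap (phi' \c n0) @^-1` b l.
have N1n : nbhs pt N1.
  apply: filterI.
    suff : \forall q \near pt, forall i, agree_near (restr (x :=
        pfam n) k (th i)) (vals t n0 (resb k i)) q by [].
    apply: filter_forall => i.
    by apply: filterS (open_nbhs_nbhs (conj (@agree_near_open _ _ _ _ (pfam n) _ _)
        (thE i))).
  apply: open_nbhs_nbhs; split; first exact: open_preimage.
  by rewrite /pt /= -smapM -compA d0E smapM.
have [n' [w [wo wp wN]]] := @small_piece _ _ _ I (pfam n) _ pt (@open_interior _ N1) N1n.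
have [|d dE] := @open_sub_factor _ _ _ _ _ w d0 wo.
  by move=> t1; rewrite (t0P t1).
(* The cover consists of [e], under [None], with the section [sigma], and of pieces off the closure
   of [b l] with arbitrary sections. *)
pose A := option {o : piece & {a : o ~> y | open_sub a /\ over (~` closure (b l)) a}}.
pose xx (a : A) : Kcat K := if a is Some a then pfam (projT1 a) else pfam e.
pose uu (a : A) : @hom (Kcat K) (xx a) y :=
  match a return @hom (Kcat K) (xx a) y with
  | Some a => sval (projT2 a) | None => v end.
pose tt (a : A) : wsec I S (xx a) :=
  match a return wsec I S (xx a) with
  | Some a => sval (cid (let: inhabits s := weighted_inhabited (pfam (projT1 a)) in
                ex_intro (fun=> True) s Logic.I)) | None => sigma end.
have [|s sP] := @weighted_patching A y xx uu tt.
  split=> [[a|]|q]; [by have [] := svalP (projT2 a)|exact: vo|].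
  have [qb|nqb] := pselect (closure (b l) q).
    by exists None; exact: blv.
  have [ o' [a [ao aq ab]]] := small_piece I (closed_openC (@closed_closure _ (b l))) nqb.
  by exists (Some (existT _ o' (exist _ a (conj ao ab)))).
exists s, (pfam n'), (n0 \c w), d; split; first exact: open_sub_comp.
  by rewrite -compA dE d0E.
pose q : @hom (Kcat K) (pfam n') z := n0 \c w.
transitivity (res (weighted_sections I S) (phi \c q) s).
  by rewrite resM.
apply: sP => a x p1 p2 [pE _]; apply: wsec_ext => o' h i.
pose p1' : x ~> n' := p1.
have oN q' : N1 (smap (w \c (p1' \c h)) q') by rewrite smapM; exact: interior_subset (wN _).
case: a p2 pE => [a|] p2 pE.
  (* A piece off the closure of [b l] cannot meet the image of [n'], which lies in [b l]. *)
  have [q' _] := piece_nonempty o'; have [_ ab] := svalP (projT2 a).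
  have hE : (phi' \c n0) \c (w \c (p1' \c h)) =
      (sval (projT2 a) : @hom X _ _) \c ((p2 : @hom X _ _) \c h).
    transitivity (((phi' \c (n0 \c w)) \c p1') \c h); first by rewrite !compA.
    by rewrite [RHS]compA; congr (_ \c h); exact: pE.
  case: (ab (smap ((p2 : @hom X _ _) \c h) q')); apply: subset_closure.
  by have := (oN q').2; rewrite /preimage /= -!smapM hE.
pose p2' : x ~> e := p2.
have p2E : p2' = k \c (w \c p1').
  apply: (open_sub_mono vo); rewrite compA kE -compA !compA.
  by apply: esym; move: pE; rewrite /q /= => <-; rewrite /phi' !compA.
have [j jE] := @resb_surj _ _ _ _ o' e (p2' \c h) i.
rewrite -[RHS]/(vals sigma (p2' \c h) i) sigmaE -jE mE.
rewrite -[LHS]/(vals t ((n0 \c w) \c (p1' \c h)) _).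
have hE : p2' \c h = k \c (w \c (p1' \c h)) by rewrite p2E !compA.
rewrite hE (@resbM _ _ _ _ o' n e) (@restrM _ _ _ _ o' n (pfam e)) -compA.
rewrite -((section_on_vals setT t).1 o' n) //.
apply: (sheaf_local Ssheaf) => q'; apply: agree_near_pull; apply: agree_near_sym.
by have [+ _] := oN q'; apply.
Qed.

End WeightedAxioms.

Theorem lemma3p23 (R : realType) (X : stack R) (K : Kcategory X)
    (I : branched_cover K) (S : presheaf (Kcat K)) :
  is_sheaf S -> Patching S -> Extension S ->
  Patching (weighted_sections I S) /\ Extension (weighted_sections I S).
Proof.
move=> Ssheaf Spatch Sext; split; first exact: weighted_patching.
exact: weighted_extension.
Qed.
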